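(* Let $H\in(1/2,1]$ and $\rho\in(1,2]$. There is a constant $C$ depending only on $H$ such that for all $m,N\in\mathbb N$ and all $f\in\mathcal B^{\otimes m}$, $$\|\mathcal A_N(f)\|_{\mathcal B^{\otimes m}}\le C^m\,\|f\|_{\mathcal B^{\otimes m}}.$$
   Context: $\mathcal B$ is the space of measurable $f:[0,1]\times\mathbb R\to\mathbb R$ with $\|f\|_{\mathcal B}:=\big(\int_0^1\int_0^1\int_{\mathbb R}|s-t|^{2H-2}|f(s,x)||f(t,x)|\,dx\,ds\,dt\big)^{1/2}<\infty$. Likewise $\mathcal B^{\otimes m}$ is the space of measurable $f:[0,1]^m\times\mathbb R^m\to\mathbb R$ with $$\|f\|_{\mathcal B^{\otimes m}}^2:=\int_{[0,1]^{2m}}\int_{\mathbb R^m}\prod_{i=1}^m|s_i-t_i|^{2H-2}\,|f(\boldsymbol s,\boldsymbol x)||f(\boldsymbol t,\boldsymbol x)|\,d\boldsymbol x\,d\boldsymbol s\,d\boldsymbol t<\infty.$$ For $N\in\mathbb N$ and $f\in\mathcal B^{\otimes m}$, $\mathcal A_N(f)$ is the block average of $f$: on each block $$B=\prod_{j=1}^m\Big(\tfrac{i_j-1}{N},\tfrac{i_j}{N}\Big]\times\prod_{j=1}^m\Big[\tfrac{k_j}{N^{1/\rho}},\tfrac{k_j+1}{N^{1/\rho}}\Big),\qquad i_1,\dots,i_m\in\{1,\dots,N\},\ k_1,\dots,k_m\in\mathbb Z,$$ $\mathcal A_N(f)$ is constant and equal to $\frac1{|B|}\int_Bf(\boldsymbol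 s,\boldsymbol y)\,d\boldsymbol s\,d\boldsymbol y$, where $|B|$ is Lebesgue measure of $B$. *)

(* Defs.v *)
From HB Require Import structures.
From mathcomp Require Import all_boot all_order all_algebra.
From mathcomp Require Import all_classical all_reals all_analysis.

Set Implicit Arguments.
Unset Strict Implicit.
Unset Printing Implicit Defensive.

Import Order.TTheory GRing.Theory Num.Theory.
Import numFieldNormedType.Exports.

Local Open Scope classical_set_scope.
Local Open Scope ring_scope.

(* Lebesgue measure on R^m, with R^m represented by m.-tuple R and its library
   product sigma-algebra (the Borel sets): leb_tuple 0 is the unit mass at the
   empty tuple, and leb_tuple m.+1 is the image of lebesgue_measure \x
   leb_tuple m under (x, t) |-> x :: t. *)
Section leb_cons.
Local Open Scope ereal_scope.
Context {R : realType} (m : nat).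

Definition tuple_cons (p : R * m.-tuple R) : m.+1.-tuple R :=
  [tuple of p.1 :: p.2].

Lemma measurable_tuple_cons : measurable_fun [set: R * m.-tuple R] tuple_cons.
Proof. exact: measurable_cons. Qed.

Variable nu : {sigma_finite_measure set (m.-tuple R) -> \bar R}.

Definition leb_cons : set (m.+1.-tuple R) -> \bar R :=
  pushforward (@lebesgue_measure R \x nu) tuple_cons.

Let leb_cons0 : leb_cons set0 = 0.
Proof. by rewrite /leb_cons /pushforward preimage_set0 measure0. Qed.

Let leb_cons_ge0 A : 0 <= leb_cons A.
Proof. by rewrite /leb_cons /pushforward; exact: measure_ge0. Qed.

Let leb_cons_sigma_additive : semi_sigma_additive leb_cons.
Proof.
move=> F mF tF mUF; rewrite /leb_cons /pushforward preimage_bigcup.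
apply: measure_semi_sigma_additive.
- by move=> n; rewrite -[X in measurable X]setTI; exact: measurable_tuple_cons.
- apply/trivIsetP => /= i j _ _ ij; rewrite -preimage_setI.
  by move/trivIsetP : tF => /(_ _ _ _ _ ij) ->//; rewrite preimage_set0.
- rewrite -preimage_bigcup -[X in measurable X]setTI.
  exact: measurable_tuple_cons.
Qed.

HB.instance Definition _ := isMeasure.Build _ _ _ leb_cons
  leb_cons0 leb_cons_ge0 leb_cons_sigma_additive.

Lemma leb_consE (A : set R) (B : set (m.-tuple R)) :
  measurable A -> measurable B ->
  leb_cons [set t | A (thead t) /\ B [tuple of behead t]] =
  lebesgue_measure A * nu B.
Proof.
move=> mA mB; rewrite -product_measure1E//; congr (product_measure1 _ _ _).
apply/seteqP; split => -[x t] /=; rewrite theadE;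
  by rewrite (_ : [tuple of behead (tuple_cons (x, t))] = t)//; exact: val_inj.
Qed.

Let leb_cons_sigma_finite : sigma_finite setT leb_cons.
Proof.
have /sigma_finiteP[F [FT ndF mF]] := sigma_finiteT (@lebesgue_measure R).
have /sigma_finiteP[G [GT ndG mG]] := sigma_finiteT nu.
exists (fun i => [set t | F i (thead t) /\ G i [tuple of behead t]]).
  apply/esym; rewrite -subTset => t _.
  have : setT (thead t) by []. rewrite FT => -[i _ Fi].
  have : setT [tuple of behead t] by []. rewrite GT => -[j _ Gj].
  exists (maxn i j) => //; split.
    by move: Fi; apply/subsetPset/ndF; exact: leq_maxl.
  by move: Gj; apply/subsetPset/ndG; exact: leq_maxr.
move=> i; have [mFi Fioo] := mF i; have [mGi Gioo] := mG i; split.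
  apply: measurableI.
  - rewrite -[X in measurable X]setTI.
    have : measurable_fun [set: m.+1.-tuple R] (fun t => tnth t ord0).
      exact: measurable_tnth.
    by move=> /(_ measurableT _ mFi).
  - rewrite -[X in measurable X]setTI.
    exact: measurable_behead.
rewrite leb_consE//; apply: lte_mul_pinfty => //.
by rewrite ge0_fin_numE.
Qed.

HB.instance Definition _ := @Measure_isSigmaFinite.Build _ _ _
  leb_cons leb_cons_sigma_finite.

End leb_cons.

Fixpoint leb_tuple {R : realType} (m : nat) :
    {sigma_finite_measure set (m.-tuple R) -> \bar R} :=
  match m with
  | 0 => \d_ ([tuple] : 0.-tuple R)
  | m'.+1 => leb_cons (leb_tuple m')
  end.

Section block_averages.
Context {R : realType}.
Implicit Types (H rho : R) (m N : nat).

Definition unit_cube m : set (m.-tuple R) :=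
  [set s | forall j, 0 <= tnth s j <= 1].
Arguments unit_cube : clear implicits.

Definition Bdomain m : set (m.-tuple R * m.-tuple R) :=
  unit_cube m `*` setT.
Arguments Bdomain : clear implicits.

(* On the diagonal s_i = t_i the library value is 0 `^ (2 * H - 2) = 0 for
   H < 1 (and 1 for H = 1) instead of +oo; the diagonal is a null set. *)
Definition Bkernel H m (s t : m.-tuple R) : R :=
  \prod_(i < m) `|tnth s i - tnth t i| `^ (2 * H - 2).

(* Only the values of f on Bdomain m matter. *)
Definition Bnorm H m (f : m.-tuple R * m.-tuple R -> R) : \bar R :=
  sqrte (\int[(leb_tuple m \x leb_tuple m)%E]_(st in unit_cube m `*` unit_cube m)
           \int[leb_tuple m]_x
             (Bkernel H st.1 st.2 * `|f (st.1, x)| * `|f (st.2, x)|)%:E)%E.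

(* The space B^{(x) m}; functions are not identified almost everywhere. *)
Definition Bspace H m : set (m.-tuple R * m.-tuple R -> R) :=
  [set f | measurable_fun (Bdomain m) f /\ (Bnorm H f < +oo)%E].
Arguments Bspace : clear implicits.

Definition block N rho m (i k : 'I_m -> int) :
    set (m.-tuple R * m.-tuple R) :=
  [set p | forall j : 'I_m,
    ((i j - 1)%:~R / N%:R < tnth p.1 j <= (i j)%:~R / N%:R) /\
    ((k j)%:~R / N%:R `^ rho^-1 <= tnth p.2 j
                                < (k j + 1)%:~R / N%:R `^ rho^-1)].
Arguments block N rho {m} i k _.

Definition average m (B : set (m.-tuple R * m.-tuple R))
    (f : m.-tuple R * m.-tuple R -> R) : R :=
  (fine ((leb_tuple m \x leb_tuple m)%E B))^-1 *
  \int[(leb_tuple m \x leb_tuple m)%E]_(p in B) f p.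

(* The block containing p has indices ceil (N s_j) and floor (N^(1/rho) x_j),
   see block_avgE. The blocks do not cover the points of Bdomain m with some
   s_j = 0, where the value is set to 0; these points form a null set. *)
Definition block_avg N rho m (f : m.-tuple R * m.-tuple R -> R)
    (p : m.-tuple R * m.-tuple R) : R :=
  if [forall j : 'I_m, 0 < tnth p.1 j <= 1] then
    average (block N rho (fun j => Num.ceil (N%:R * tnth p.1 j))
                         (fun j => Num.floor (N%:R `^ rho^-1 * tnth p.2 j))) f
  else 0.

Lemma block_avgE N rho m (f : m.-tuple R * m.-tuple R -> R) (i k : 'I_m -> int)
    (p : m.-tuple R * m.-tuple R) : (0 < N)%N ->
  (forall j, 1 <= i j <= N%:Z) -> block N rho i k p ->
  block_avg N rho f p = average (block N rho i k) f.
Proof.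
move=> N0 iN Bp; have N0R : 0 < N%:R :> R by rewrite ltr0n.
have Nr0 : 0 < N%:R `^ rho^-1 :> R by rewrite powR_gt0.
rewrite /block_avg ifT; last first.
  apply/forallP => j; have [/andP[l1 l2] _] := Bp j.
  have /andP[i1 i2] := iN j; apply/andP; split.
    by apply: le_lt_trans l1; rewrite divr_ge0 ?ler0z ?subr_ge0// ltW.
  by apply: (le_trans l2); rewrite ler_pdivrMr// mul1r -[leRHS]/(N%:Z%:~R) ler_int.
have -> : (fun j => Num.ceil (N%:R * tnth p.1 j)) = i.
  apply/funext => j; have [l _] := Bp j; apply/ceil_def.
  by rewrite mulrC -ltr_pdivrMr// -ler_pdivlMr.
have -> // : (fun j => Num.floor (N%:R `^ rho^-1 * tnth p.2 j)) = k.
apply/funext => j; have [_ l] := Bp j; apply/floor_def.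
by rewrite mulrC -ler_pdivrMr// -ltr_pdivlMr.
Qed.

End block_averages.

Arguments unit_cube {R} m _.
Arguments Bdomain {R} m _.
Arguments Bspace {R} H m _.
Arguments block {R} N rho {m} i k _.

(* Main.v *)
Require Import Defs.
From HB Require Import structures.
From mathcomp Require Import all_boot all_order all_algebra.
From mathcomp Require Import all_classical all_reals all_analysis.
From mathcomp Require Import measurable_realfun ring lra.

(** Put al = 2 - 2 H, so that al lies in [0, 1), and write kappa(s, t) for the
    product over i of |s_i - t_i|^(-al). The squared norm of f is the energy of
    G = |f|, namely the integral over x of the quadratic form of kappa at the
    function s |-> G(s, x). Since |block_avg f| is at most the block average of
    |f|, and since a block is a product of a time cell and a space cell, it is
    enough to bound the energy of B (A G), where A averages over the time cells
    and B over the space cells ([le_block_avg]). The two averages are handled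
    by different mechanisms.

    Time. A is a symmetric integral operator, so it can be moved from the
    function onto the kernel ([quad_kernel_op]): the energy of A G is the
    energy of G for the kernel averaged over pairs of cells. Averages of tensor
    products factor over the coordinates, hence only the line matters, where
    the averaged kernel is at most a constant times |s - t|^(-al)
    ([riesz_cell_mean]): cells that are far apart see the kernel as almost
    constant, and for close cells the singularity is integrable.

    Space. Here B mixes the functions G(., y) for different y, and what is
    needed is positive definiteness. For al > 0, |s - t|^(-al) is up to
    constants the Gram kernel of phi(s, u) = |s - u|^(-(1 + al) / 2), that is
    the integral over u of phi(s, u) phi(t, u) ([riesz_feature]). For a Gram
    kernel with feature Phi the energy is the integral over x and w of the
    square of the integral over s of Phi(s, w) G(s, x), and averaging in x
    contracts squares in L2 ([energy_space_mean]).

    Passing between the kernels costs one constant per coordinate, independent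
    of the mesh; hence the factor C^m for the energy ([energy_block_mean]) and
    sqrt(C)^m for the norm. The pointwise comparisons can fail where
    s_i = t_i for some i, because of the value of 0^(-al), but such t form a
    null set for every s ([negligible_diagonal]). All integrals are kept in
    [0, +oo], so no finiteness has to be tracked. *)

Set Implicit Arguments.
Unset Strict Implicit.
Unset Printing Implicit Defensive.

Import Order.TTheory GRing.Theory Num.Theory.
Import numFieldNormedType.Exports.

Local Open Scope classical_set_scope.
Local Open Scope ring_scope.

(** * Integrals of nonnegative kernels *)

Section kernels.
Local Open Scope ereal_scope.
Context {R : realType}.
Import HBNNSimple.

(** Kernels are kept curried, to be partially applied under integrals; joint
    measurability is a statement about pairs. *)
Definition measurable_fun2 d1 d2 (X : measurableType d1)
    (Y : measurableType d2) (K : X -> Y -> \bar R) :=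
  measurable_fun setT ((fun p => K p.1 p.2) : X * Y -> \bar R).

(** The integral of a nonnegative function is a supremum over the simple
    functions below it, so monotonicity needs no measurability. It is applied
    to block averages, whose measurability is thus never an issue. *)
Lemma ge0_le_integral_nonmeas d (T : measurableType d)
    (mu : {measure set T -> \bar R}) (D : set T) (f g : T -> \bar R) :
  (forall x, D x -> 0 <= f x) -> (forall x, D x -> f x <= g x) ->
  \int[mu]_(x in D) f x <= \int[mu]_(x in D) g x.
Proof.
move=> f0 fg; rewrite !ge0_integralE//; last first.
  by move=> x Dx; exact: le_trans (f0 x Dx) (fg x Dx).
apply: ereal_sup_le => _ /= [h hf <-]; exists h => // x;
  apply: le_trans (hf x) _; rewrite /patch.
by case: ifPn => // /[!inE] /fg.
Qed.

Lemma measurable_fun2_comp d1 d2 d3 (X : measurableType d1)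
    (Y : measurableType d2) (Z : measurableType d3) (K : X -> Y -> \bar R)
    (f : Z -> X) (g : Z -> Y) :
  measurable_fun2 K -> measurable_fun setT f -> measurable_fun setT g ->
  measurable_fun setT (fun z => K (f z) (g z)).
Proof.
move=> mK mf mg.
exact: (measurableT_comp mK (measurable_fun_pair mf mg)).
Qed.

Lemma measurable_fun2C d1 d2 (X : measurableType d1)
    (Y : measurableType d2) (K : X -> Y -> \bar R) :
  measurable_fun2 K -> measurable_fun2 (fun y x => K x y).
Proof. by move=> mK; exact: (measurable_fun2_comp mK). Qed.

Lemma measurable_fun2l d1 d2 (X : measurableType d1)
    (Y : measurableType d2) (K : X -> Y -> \bar R) x :
  measurable_fun2 K -> measurable_fun setT (K x).
Proof. by move=> mK; exact: (measurable_fun2_comp mK). Qed.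

Lemma measurable_fun2r d1 d2 (X : measurableType d1)
    (Y : measurableType d2) (K : X -> Y -> \bar R) y :
  measurable_fun2 K -> measurable_fun setT (K ^~ y).
Proof. by move=> mK; exact: (measurable_fun2_comp mK). Qed.

Lemma measurable_integral d1 d2 (X : measurableType d1)
    (Y : measurableType d2) (nu : {sigma_finite_measure set Y -> \bar R})
    (K : X -> Y -> \bar R) :
  measurable_fun2 K -> (forall x y, 0 <= K x y) ->
  measurable_fun setT (fun x => \int[nu]_y K x y).
Proof.
move=> mK K0.
exact: (measurable_fun_fubini_tonelli_F (fun p => K p.1 p.2)).
Qed.

Lemma tonelli d1 d2 (X : measurableType d1) (Y : measurableType d2)
    (mu : {sigma_finite_measure set X -> \bar R})
    (nu : {sigma_finite_measure set Y -> \bar R}) (K : X -> Y -> \bar R) :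
  measurable_fun2 K -> (forall x y, 0 <= K x y) ->
  \int[mu]_x \int[nu]_y K x y = \int[nu]_y \int[mu]_x K x y.
Proof.
by move=> mK K0; rewrite (fubini_tonelli (fun p => K p.1 p.2))//.
Qed.

Section composition.
Context d1 d2 (Y : measurableType d1) (Z : measurableType d2).
Variables (mu : {sigma_finite_measure set Y -> \bar R})
  (nu : {sigma_finite_measure set Z -> \bar R}).
Variables (k : Y -> \bar R) (L : Y -> Z -> \bar R) (h : Z -> \bar R).
Hypotheses (mk : measurable_fun setT k) (mL : measurable_fun2 L)
  (mh : measurable_fun setT h).
Hypotheses (k0 : forall y, 0 <= k y) (L0 : forall y z, 0 <= L y z)
  (h0 : forall z, 0 <= h z).

(** Tonelli's theorem, read as associativity of the composition of kernels. *)
Lemma integral_kernel_assoc :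
  \int[mu]_y (k y * \int[nu]_z (L y z * h z)) =
  \int[nu]_z ((\int[mu]_y (k y * L y z)) * h z).
Proof.
transitivity (\int[mu]_y \int[nu]_z (k y * L y z * h z)).
  apply: eq_integral => y _; rewrite -ge0_integralZl//.
  - by apply: eq_integral => z _; rewrite muleA.
  - by apply: emeasurable_funM => //; exact: measurable_fun2l.
  - by move=> z _; rewrite mule_ge0.
rewrite tonelli//.
- apply: eq_integral => z _; rewrite ge0_integralZr//.
  - by apply: emeasurable_funM => //; exact: measurable_fun2r.
  - by move=> y _; rewrite mule_ge0.
- apply: emeasurable_funM; last exact: measurableT_comp.
  by apply: emeasurable_funM => //; exact: measurableT_comp.
- by move=> y z; rewrite !mule_ge0.
Qed.

End composition.

Section quadratic_form.
Context d (T : measurableType d).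
Variable mu : {sigma_finite_measure set T -> \bar R}.
Implicit Types (kappa a : T -> T -> \bar R) (h : T -> \bar R).

Definition quad kappa h := \int[mu]_s \int[mu]_t (kappa s t * h s * h t).

Lemma quadE kappa h : measurable_fun2 kappa -> measurable_fun setT h ->
  (forall s t, 0 <= kappa s t) -> (forall s, 0 <= h s) ->
  quad kappa h = \int[mu]_s (h s * \int[mu]_t (kappa s t * h t)).
Proof.
move=> mk mh k0 h0; apply: eq_integral => s _; rewrite -ge0_integralZl//.
- by apply: eq_integral => t _; rewrite muleA [h s * _]muleC.
- by apply: emeasurable_funM => //; exact: measurable_fun2l.
- by move=> t _; rewrite mule_ge0.
Qed.

(** A kernel operator inside a quadratic form moves onto the kernel:
    associativity is used once for the variable t and once for the variable
    s. *)
Lemma quad_kernel_op kappa a h : measurable_fun2 kappa -> measurable_fun2 a ->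
  measurable_fun setT h -> (forall s t, 0 <= kappa s t) ->
  (forall s t, 0 <= a s t) -> (forall s, 0 <= h s) ->
  quad kappa (fun s => \int[mu]_s' (a s s' * h s')) =
  quad (fun s' t' => \int[mu]_s ((\int[mu]_t (kappa s t * a t t')) * a s s')) h.
Proof.
move=> mk ma mh k0 a0 h0.
have mah : measurable_fun setT (fun s => \int[mu]_s' (a s s' * h s')).
  apply: (measurable_integral _ (K := fun s s' => a s s' * h s')).
    by apply: emeasurable_funM => //; exact: measurableT_comp.
  by move=> s s'; rewrite mule_ge0.
have ah0 s : 0 <= \int[mu]_s' (a s s' * h s').
  by apply: integral_ge0 => s' _; rewrite mule_ge0.
have k10 s t' : 0 <= \int[mu]_t (kappa s t * a t t').
  by apply: integral_ge0 => t _; rewrite mule_ge0.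
have mk1 : measurable_fun2 (fun s t' => \int[mu]_t (kappa s t * a t t')).
  apply: (measurable_integral _
    (K := fun (p : T * T) t => kappa p.1 t * a t p.2)).
    apply: emeasurable_funM.
      apply: (measurable_fun2_comp mk) => //; exact: measurableT_comp.
    apply: (measurable_fun2_comp ma) => //; exact: measurableT_comp.
  by move=> p t; rewrite mule_ge0.
have k20 s' t' : 0 <= \int[mu]_s ((\int[mu]_t (kappa s t * a t t')) * a s s').
  by apply: integral_ge0 => t _; rewrite mule_ge0.
rewrite quadE//.
have -> : \int[mu]_s (\int[mu]_s' (a s s' * h s') *
      \int[mu]_t (kappa s t * \int[mu]_s' (a t s' * h s'))) =
    \int[mu]_s (\int[mu]_s' (a s s' * h s') *
      \int[mu]_t' (\int[mu]_t (kappa s t * a t t') * h t')).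
  apply: eq_integral => s _.
  by rewrite integral_kernel_assoc//; exact: measurable_fun2l.
rewrite integral_kernel_assoc//.
rewrite /quad tonelli; last 2 first.
- apply: emeasurable_funM; last exact: measurableT_comp.
  apply: emeasurable_funM; last exact: measurableT_comp.
  apply: (measurable_integral _ (K := fun (p : T * T) s =>
    (\int[mu]_t (kappa s t * a t p.2)) * a s p.1)).
    apply: emeasurable_funM.
      apply: (measurable_fun2_comp mk1) => //; exact: measurableT_comp.
    apply: (measurable_fun2_comp ma) => //; exact: measurableT_comp.
  by move=> p s; rewrite mule_ge0.
- by move=> s' t'; rewrite !mule_ge0.
apply: eq_integral => t' _.
rewrite ge0_integralZr//; last 2 first.
- apply: emeasurable_funM => //.
  apply: (measurable_integral _ (K := fun s' s =>
    (\int[mu]_t (kappa s t * a t t')) * a s s')).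
    apply: emeasurable_funM.
      apply: (measurable_fun2_comp mk1) => //; exact: measurableT_comp.
    exact: (measurable_fun2_comp ma).
  by move=> s' s; rewrite mule_ge0.
- by move=> s' _; rewrite mule_ge0.
congr (_ * _).
transitivity (\int[mu]_s ((\int[mu]_t (kappa s t * a t t')) *
    \int[mu]_s' (a s s' * h s'))).
  by apply: eq_integral => s _; rewrite muleC.
have mk1t : measurable_fun setT (fun s => \int[mu]_t (kappa s t * a t t')).
  exact: (measurable_fun2_comp mk1).
by rewrite integral_kernel_assoc.
Qed.

End quadratic_form.

End kernels.

(** * Energies and averaging operators *)

Section energy.
Local Open Scope ereal_scope.
Context {R : realType}.

Lemma mule2n_le_sqr (a b : \bar R) : 0 <= a -> 0 <= b ->
  2%:E * (a * b) <= a * a + b * b.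
Proof.
case: a => [a| |]// + ; case: b => [b| |]//.
- by move=> _ _; have := sqr_ge0 (a - b)%R; rewrite -!EFinM -EFinD lee_fin; nra.
- by move=> a0 _; rewrite [+oo * +oo]mulyy addey ?leey// -EFinM.
- by move=> _ b0; rewrite [+oo * +oo]mulyy addye ?leey// -EFinM.
- by move=> _ _; rewrite !mulyy gt0_muley ?lte_fin.
Qed.

(** Jensen's inequality for the square and the probability density b:
    integrate 2 G(y) G(z) <= G(y)^2 + G(z)^2 against b(y) b(z). Unlike an
    argument by variances, this makes sense when the integrals are
    infinite. *)
Lemma sqr_mean_le d (T : measurableType d)
    (mu : {sigma_finite_measure set T -> \bar R}) (b G : T -> \bar R) :
  measurable_fun setT b -> measurable_fun setT G ->
  (forall y, 0 <= b y) -> (forall y, 0 <= G y) -> \int[mu]_y b y = 1 ->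
  (\int[mu]_y (b y * G y)) * (\int[mu]_y (b y * G y)) <=
  \int[mu]_y (b y * (G y * G y)).
Proof.
move=> mb mG b0 G0 b1.
have mbG : measurable_fun setT (fun y => b y * G y) by exact: emeasurable_funM.
have mbGG : measurable_fun setT (fun y => b y * (G y * G y)).
  by apply: emeasurable_funM => //; exact: emeasurable_funM.
have bG0 y : 0 <= b y * G y by rewrite mule_ge0.
have bGG0 y : 0 <= b y * (G y * G y) by rewrite !mule_ge0.
have I0 : 0 <= \int[mu]_y (b y * G y) by exact: integral_ge0.
have J0 : 0 <= \int[mu]_y (b y * (G y * G y)) by exact: integral_ge0.
rewrite -(@lee_pmul2l _ 2%:E) ?lte_fin//.
rewrite -ge0_integralZr// -ge0_integralZl//; last 2 first.
- exact: emeasurable_funM.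
- by move=> y _; rewrite mule_ge0.
set S := \int[mu]_y (b y * (G y * G y)).
apply: (@le_trans _ _ (\int[mu]_y (b y * (G y * G y) + b y * S))); last first.
  rewrite ge0_integralD//; last 2 first.
  - by move=> y _; rewrite mule_ge0.
  - exact: emeasurable_funM.
  rewrite ge0_integralZr// b1 mul1e -/S.
  by rewrite mule_natl mule2n.
apply: ge0_le_integral_nonmeas => y _; first by rewrite !mule_ge0// lee_fin.
rewrite -ge0_integralZl// -ge0_integralZl//; last 2 first.
- exact: emeasurable_funM.
- by move=> z _; rewrite mule_ge0.
rewrite -[X in _ <= X + _]mule1 -b1 -ge0_integralZl// -ge0_integralZl//.
rewrite -ge0_integralD//; last 4 first.
- by move=> z _; rewrite mule_ge0.
- exact: emeasurable_funM.
- by move=> z _; rewrite mule_ge0.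
- exact: emeasurable_funM.
apply: ge0_le_integral_nonmeas => z _; first by rewrite !mule_ge0// lee_fin.
rewrite (_ : b y * G y * (b z * G z) = b y * b z * (G y * G z)); last first.
  by rewrite muleACA.
rewrite muleCA [X in _ <= X + _]muleAC [X in _ + X]muleA.
rewrite -ge0_muleDr ?mule_ge0//.
by apply: lee_wpmul2l; [rewrite mule_ge0|exact: mule2n_le_sqr].
Qed.

Section gram_kernels.
Context d (T : measurableType d).
Variable mu : {sigma_finite_measure set T -> \bar R}.

(** Jensen's inequality on each row of b, then the unit mass of each
    column. *)
Lemma L2_contraction (b : T -> T -> \bar R) (G : T -> \bar R) :
  measurable_fun2 b -> measurable_fun setT G ->
  (forall x y, 0 <= b x y) -> (forall y, 0 <= G y) ->
  (forall x, \int[mu]_y b x y = 1) -> (forall y, \int[mu]_x b x y = 1) ->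
  \int[mu]_x ((\int[mu]_y (b x y * G y)) * (\int[mu]_y (b x y * G y))) <=
  \int[mu]_y (G y * G y).
Proof.
move=> mb mG b0 G0 b1 b1'.
have mGG : measurable_fun setT (fun y => G y * G y) by exact: emeasurable_funM.
apply: (@le_trans _ _ (\int[mu]_x \int[mu]_y (b x y * (G y * G y)))).
  apply: ge0_le_integral_nonmeas => x _.
    by rewrite mule_ge0// integral_ge0// => y _; rewrite mule_ge0.
  by apply: sqr_mean_le => //; exact: measurable_fun2l mb.
rewrite tonelli; last 2 first.
- apply: emeasurable_funM => //; exact: (measurableT_comp mGG measurable_snd).
- by move=> x y; rewrite !mule_ge0.
apply: ge0_le_integral_nonmeas => y _.
  by rewrite integral_ge0// => x _; rewrite !mule_ge0.
have mby : measurable_fun setT (b ^~ y) by exact: measurable_fun2r mb.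
by rewrite ge0_integralZr// ?b1' ?mul1e// mule_ge0.
Qed.

(** The quadratic form of a Gram kernel is a sum of squares. *)
Lemma quad_feature d' (W : measurableType d')
    (nu : {sigma_finite_measure set W -> \bar R})
    (phi : T -> W -> \bar R) (h : T -> \bar R) :
  measurable_fun2 phi -> measurable_fun setT h ->
  (forall s w, 0 <= phi s w) -> (forall s, 0 <= h s) ->
  quad mu (fun s t => \int[nu]_w (phi s w * phi t w)) h =
  \int[nu]_w ((\int[mu]_s (phi s w * h s)) * (\int[mu]_s (phi s w * h s))).
Proof.
move=> mphi mh phi0 h0.
have mP : measurable_fun setT (fun w => \int[mu]_s (phi s w * h s)).
  apply: (measurable_integral _ (K := fun w s => phi s w * h s)).
    apply: emeasurable_funM; last exact: measurableT_comp.
    exact: (measurable_fun2_comp mphi).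
  by move=> w s; rewrite mule_ge0.
have P0 w : 0 <= \int[mu]_s (phi s w * h s).
  by apply: integral_ge0 => s _; rewrite mule_ge0.
have mphiC : measurable_fun2 (fun w s => phi s w) by exact: measurable_fun2C.
rewrite quadE//; last 2 first.
- apply: (measurable_integral _
    (K := fun (p : T * T) w => phi p.1 w * phi p.2 w)).
    apply: emeasurable_funM.
      apply: (measurable_fun2_comp mphi) => //; exact: measurableT_comp.
    apply: (measurable_fun2_comp mphi) => //; exact: measurableT_comp.
  by move=> p w; rewrite mule_ge0.
- by move=> s t; apply: integral_ge0 => w _; rewrite mule_ge0.
transitivity (\int[mu]_s (h s *
    \int[nu]_w (phi s w * \int[mu]_s (phi s w * h s)))).
  apply: eq_integral => s _; congr (_ * _).
  have mphis : measurable_fun setT (phi s) by exact: measurable_fun2l mphi.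
  by have -> := integral_kernel_assoc nu mu mphis mphiC mh (phi0 s)
    (fun w t => phi0 t w) h0.
have -> := integral_kernel_assoc mu nu mh mphi mP h0 phi0 P0.
apply: eq_integral => w _; congr (_ * _).
by apply: eq_integral => s _; rewrite muleC.
Qed.

(** The space integral is the outermost one, so that for each x only a
    quadratic form in the time variable is left. *)
Definition energy (kappa g : T -> T -> \bar R) :=
  \int[mu]_x quad mu kappa (g ^~ x).

Lemma energy_ge0 (kappa g : T -> T -> \bar R) :
  (forall s t, 0 <= kappa s t) -> (forall s x, 0 <= g s x) ->
  0 <= energy kappa g.
Proof.
by move=> k0 g0; do 3 apply: integral_ge0 => ? _; rewrite !mule_ge0.
Qed.

Lemma measurable_quad (kappa g : T -> T -> \bar R) :
  measurable_fun2 kappa -> measurable_fun2 g ->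
  (forall s t, 0 <= kappa s t) -> (forall s x, 0 <= g s x) ->
  measurable_fun setT (fun x => quad mu kappa (g ^~ x)).
Proof.
move=> mk mg k0 g0.
apply: (measurable_integral _
  (K := fun x s => \int[mu]_t (kappa s t * g s x * g t x))); last first.
  by move=> x s; apply: integral_ge0 => t _; rewrite !mule_ge0.
apply: (measurable_integral _
  (K := fun (p : T * T) t => kappa p.2 t * g p.2 p.1 * g t p.1)); last first.
  by move=> p t; rewrite !mule_ge0.
apply: emeasurable_funM; first apply: emeasurable_funM.
- by apply: (measurable_fun2_comp mk) => //; exact: measurableT_comp.
- by apply: (measurable_fun2_comp mg) => //; exact: measurableT_comp.
- by apply: (measurable_fun2_comp mg) => //; exact: measurableT_comp.
Qed.

(** For each w, integration against phi(., w) commutes with the average in x;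
    what remains is the contraction of the squares in L2. *)
Lemma energy_space_mean d' (W : measurableType d')
    (nu : {sigma_finite_measure set W -> \bar R})
    (phi : T -> W -> \bar R) (b g : T -> T -> \bar R) :
  measurable_fun2 phi -> measurable_fun2 b -> measurable_fun2 g ->
  (forall s w, 0 <= phi s w) -> (forall x y, 0 <= b x y) ->
  (forall s x, 0 <= g s x) ->
  (forall x, \int[mu]_y b x y = 1) -> (forall y, \int[mu]_x b x y = 1) ->
  energy (fun s t => \int[nu]_w (phi s w * phi t w))
    (fun s x => \int[mu]_y (b x y * g s y)) <=
  energy (fun s t => \int[nu]_w (phi s w * phi t w)) g.
Proof.
move=> mphi mb mg phi0 b0 g0 b1 b1'.
have mG : measurable_fun2 (fun w x => \int[mu]_s (phi s w * g s x)).
  apply: (measurable_integral _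
    (K := fun (p : W * T) s => phi s p.1 * g s p.2)).
    apply: emeasurable_funM.
      apply: (measurable_fun2_comp mphi) => //; exact: measurableT_comp.
    apply: (measurable_fun2_comp mg) => //; exact: measurableT_comp.
  by move=> p s; rewrite mule_ge0.
have G0 w x : 0 <= \int[mu]_s (phi s w * g s x).
  by apply: integral_ge0 => s _; rewrite mule_ge0.
have bG0 w x : 0 <= \int[mu]_y (b x y * \int[mu]_s (phi s w * g s y)).
  by apply: integral_ge0 => y _; rewrite mule_ge0.
have mbG : measurable_fun2
    (fun w x => \int[mu]_y (b x y * \int[mu]_s (phi s w * g s y))).
  apply: (measurable_integral _
    (K := fun (p : W * T) y => b p.2 y * \int[mu]_s (phi s p.1 * g s y))).
    apply: emeasurable_funM.
      apply: (measurable_fun2_comp mb) => //; exact: measurableT_comp.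
    apply: (measurable_fun2_comp mG) => //; exact: measurableT_comp.
  by move=> p y; rewrite mule_ge0.
have -> : energy (fun s t => \int[nu]_w (phi s w * phi t w)) g =
    \int[nu]_w \int[mu]_x ((\int[mu]_s (phi s w * g s x)) *
                           (\int[mu]_s (phi s w * g s x))).
  rewrite tonelli; last 2 first.
  - exact: emeasurable_funM.
  - by move=> w x; rewrite mule_ge0.
  apply: eq_integral => x _.
  exact: (quad_feature nu mphi (measurable_fun2r x mg) phi0 (g0 ^~ x)).
have -> : energy (fun s t => \int[nu]_w (phi s w * phi t w))
      (fun s x => \int[mu]_y (b x y * g s y)) =
    \int[nu]_w \int[mu]_x (
      (\int[mu]_y (b x y * \int[mu]_s (phi s w * g s y))) *
      (\int[mu]_y (b x y * \int[mu]_s (phi s w * g s y)))).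
  rewrite tonelli; last 2 first.
  - exact: emeasurable_funM.
  - by move=> w x; rewrite mule_ge0.
  apply: eq_integral => x _.
  have mbg : measurable_fun setT (fun s => \int[mu]_y (b x y * g s y)).
    apply: (measurable_integral _ (K := fun s y => b x y * g s y)).
      apply: emeasurable_funM => //.
      exact: (measurable_fun2_comp mb).
    by move=> s y; rewrite mule_ge0.
  have bg0 s : 0 <= \int[mu]_y (b x y * g s y).
    by apply: integral_ge0 => y _; rewrite mule_ge0.
  have -> := quad_feature nu mphi mbg phi0 bg0.
  apply: eq_integral => w _.
  suff -> : \int[mu]_s (phi s w * \int[mu]_y (b x y * g s y)) =
    \int[mu]_y (b x y * \int[mu]_s (phi s w * g s y)) by [].
  have mpw : measurable_fun setT (phi ^~ w) by exact: measurable_fun2r mphi.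
  have mbx : measurable_fun setT (b x) by exact: measurable_fun2l mb.
  transitivity (\int[mu]_s (phi s w * \int[mu]_y (g s y * b x y))).
    apply: eq_integral => s _; congr (_ * _).
    by apply: eq_integral => y _; rewrite muleC.
  have -> := integral_kernel_assoc mu mu mpw mg mbx (phi0 ^~ w) g0 (b0 x).
  by apply: eq_integral => y _; rewrite muleC.
apply: ge0_le_integral_nonmeas => w _.
  by apply: integral_ge0 => x _; rewrite mule_ge0.
apply: L2_contraction => //; exact: measurable_fun2l mG.
Qed.

(** Null exceptional sets D s suffice because each s leaves an integral in
    t. *)
Lemma quad_le (c : R) (D : T -> set T) (k1 k2 : T -> T -> \bar R)
    (h : T -> \bar R) :
  measurable_fun2 k1 -> measurable_fun2 k2 -> measurable_fun setT h ->
  (0 <= c)%R -> (forall s t, 0 <= k1 s t) -> (forall s t, 0 <= k2 s t) ->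
  (forall s, 0 <= h s) ->
  (forall s, mu.-negligible (D s)) ->
  (forall s t, ~ D s t -> k1 s t <= c%:E * k2 s t) ->
  quad mu k1 h <= c%:E * quad mu k2 h.
Proof.
move=> mk1 mk2 mh c0 k10 k20 h0 D0 k12.
have mk2h : measurable_fun2 (fun s t => k2 s t * h s * h t).
  apply: emeasurable_funM; last exact: measurableT_comp.
  by apply: emeasurable_funM => //; exact: measurableT_comp.
have k2h0 s t : 0 <= k2 s t * h s * h t by rewrite !mule_ge0.
rewrite -ge0_integralZl//; last 2 first.
- exact: (measurable_integral _ (K := fun s t => k2 s t * h s * h t)).
- by move=> s _; apply: integral_ge0.
apply: ge0_le_integral_nonmeas => s _.
  by apply: integral_ge0 => t _; rewrite !mule_ge0.
rewrite -ge0_integralZl//; last exact: measurable_fun2l mk2h.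
apply: ae_ge0_le_integral => //.
- by move=> t _; rewrite !mule_ge0.
- apply: emeasurable_funM => //.
  by apply: emeasurable_funM => //; exact: measurable_fun2l mk1.
- by move=> t _; rewrite !mule_ge0.
- by apply: emeasurable_funM => //; exact: measurable_fun2l mk2h.
- apply: negligibleS (D0 s) => t /=; apply: contra_notP => nD _.
  rewrite !muleA -!(muleA _ (h s)); apply: lee_wpmul2r.
    by rewrite mule_ge0.
  exact: k12.
Qed.

End gram_kernels.
End energy.

Section energy_theory.
Local Open Scope ereal_scope.
Context {R : realType}.

Lemma energy_le d (T : measurableType d)
    (mu : {sigma_finite_measure set T -> \bar R}) (c : R) (D : T -> set T)
    (k1 k2 g : T -> T -> \bar R) :
  measurable_fun2 k1 -> measurable_fun2 k2 -> measurable_fun2 g ->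
  (0 <= c)%R -> (forall s t, 0 <= k1 s t) -> (forall s t, 0 <= k2 s t) ->
  (forall s x, 0 <= g s x) ->
  (forall s, mu.-negligible (D s)) ->
  (forall s t, ~ D s t -> k1 s t <= c%:E * k2 s t) ->
  energy mu k1 g <= c%:E * energy mu k2 g.
Proof.
move=> mk1 mk2 mg c0 k10 k20 g0 D0 k12.
have mq := measurable_quad mu mk2 mg k20 g0.
have q0 x : 0 <= quad mu k2 (g ^~ x).
  by do 2 apply: integral_ge0 => ? _; rewrite !mule_ge0.
rewrite /energy -ge0_integralZl//.
apply: ge0_le_integral_nonmeas => x _.
  by do 2 apply: integral_ge0 => ? _; rewrite !mule_ge0.
apply: (quad_le mk1 mk2 (measurable_fun2r x mg) c0 k10 k20 _ D0 k12) => s.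
exact: g0.
Qed.

Lemma energyE d (T : measurableType d)
    (mu : {sigma_finite_measure set T -> \bar R}) (k g : T -> T -> \bar R) :
  measurable_fun2 k -> measurable_fun2 g ->
  (forall s t, 0 <= k s t) -> (forall s x, 0 <= g s x) ->
  energy mu k g = \int[mu \x mu]_st
    \int[mu]_x (k st.1 st.2 * g st.1 x * g st.2 x).
Proof.
move=> mk mg k0 g0.
have mK d' (Z : measurableType d') (p q r : Z -> T) :
    measurable_fun setT p -> measurable_fun setT q -> measurable_fun setT r ->
    measurable_fun setT
      (fun z => k (p z) (q z) * g (p z) (r z) * g (q z) (r z)).
  move=> mp mq mr; apply: emeasurable_funM; first apply: emeasurable_funM.
  - exact: (measurable_fun2_comp mk).
  - exact: (measurable_fun2_comp mg).
  - exact: (measurable_fun2_comp mg).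
have K0 s t x : 0 <= k s t * g s x * g t x by rewrite !mule_ge0.
rewrite (fubini_tonelli1
  (fun st => \int[mu]_x (k st.1 st.2 * g st.1 x * g st.2 x))).
- have mKt : measurable_fun2
      (fun x s => \int[mu]_t (k s t * g s x * g t x)).
    apply: (measurable_integral mu
      (K := fun (p : T * T) t => k p.2 t * g p.2 p.1 * g t p.1)) => //.
    by apply: mK => //; exact: measurableT_comp.
  have Kt0 x s : 0 <= \int[mu]_t (k s t * g s x * g t x).
    exact: integral_ge0.
  have -> : energy mu k g = _ := tonelli mu mu mKt Kt0.
  apply: eq_integral => s _; rewrite /fubini_F tonelli//.
  by apply: (mK _ _ (cst s) snd fst).
- apply: (measurable_integral mu
    (K := fun (p : T * T) x => k p.1 p.2 * g p.1 x * g p.2 x)) => //.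
  by apply: mK => //; exact: measurableT_comp.
- by move=> st; exact: integral_ge0.
Qed.

Lemma measurable_time_mean d (T : measurableType d)
    (mu : {sigma_finite_measure set T -> \bar R}) (a g : T -> T -> \bar R) :
  measurable_fun2 a -> measurable_fun2 g ->
  (forall s t, 0 <= a s t) -> (forall s x, 0 <= g s x) ->
  measurable_fun2 (fun s x => \int[mu]_s' (a s s' * g s' x)).
Proof.
move=> ma mg a0 g0; apply: (measurable_integral mu
    (K := fun (p : T * T) s' => a p.1 s' * g s' p.2)).
  apply: emeasurable_funM.
    by apply: (measurable_fun2_comp ma) => //; exact: measurableT_comp.
  by apply: (measurable_fun2_comp mg) => //; exact: measurableT_comp.
by move=> p s'; rewrite mule_ge0.
Qed.

Lemma measurable_space_mean d (T : measurableType d)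
    (mu : {sigma_finite_measure set T -> \bar R}) (b g : T -> T -> \bar R) :
  measurable_fun2 b -> measurable_fun2 g ->
  (forall s t, 0 <= b s t) -> (forall s x, 0 <= g s x) ->
  measurable_fun2 (fun s x => \int[mu]_y (b x y * g s y)).
Proof.
move=> mb mg b0 g0; apply: (measurable_integral mu
    (K := fun (p : T * T) y => b p.2 y * g p.1 y)).
  apply: emeasurable_funM.
    by apply: (measurable_fun2_comp mb) => //; exact: measurableT_comp.
  by apply: (measurable_fun2_comp mg) => //; exact: measurableT_comp.
by move=> p s'; rewrite mule_ge0.
Qed.

(** This is how a time average followed by a space average becomes one average
    over a block. *)
Lemma iterated_mean_prod d (T : measurableType d)
    (mu : {sigma_finite_measure set T -> \bar R}) (a b : T -> \bar R)
    (g : T -> T -> \bar R) :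
  measurable_fun setT a -> measurable_fun setT b -> measurable_fun2 g ->
  (forall s, 0 <= a s) -> (forall y, 0 <= b y) -> (forall s x, 0 <= g s x) ->
  \int[mu]_y (b y * \int[mu]_s (a s * g s y)) =
  \int[mu \x mu]_q (a q.1 * b q.2 * g q.1 q.2).
Proof.
move=> ma mb mg a0 b0 g0.
rewrite (fubini_tonelli2 (fun q => a q.1 * b q.2 * g q.1 q.2)); last 2 first.
- apply: emeasurable_funM => //.
  apply: emeasurable_funM.
    exact: (measurableT_comp ma).
  exact: (measurableT_comp mb).
- by move=> q; rewrite !mule_ge0.
apply: eq_integral => y _; rewrite /fubini_G/= -ge0_integralZl//.
- by apply: eq_integral => s _; rewrite muleCA muleA.
- by apply: emeasurable_funM => //; exact: (measurable_fun2r y mg).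
- by move=> s _; rewrite mule_ge0.
Qed.

End energy_theory.

(** * Tensor powers of kernels on the line *)

Section tensor.
Local Open Scope ereal_scope.
Context {R : realType}.

Lemma emeasurable_prod d (T : measurableType d) (I : Type) (r : seq I)
    (h : I -> T -> \bar R) :
  (forall i, measurable_fun setT (h i)) ->
  measurable_fun setT (fun x => \prod_(i <- r) h i x).
Proof.
move=> mh; elim: r => [|i r IH].
  by under eq_fun do rewrite big_nil; exact: measurable_cst.
by under eq_fun do rewrite big_cons; exact: emeasurable_funM.
Qed.

(** [leb_tuple] is built one coordinate at a time, so the factorization
    follows by induction from Tonelli's theorem. *)
Lemma integral_leb_tuple_prod m (F : 'I_m -> R -> \bar R) :
  (forall i, measurable_fun setT (F i)) -> (forall i x, 0 <= F i x) ->
  \int[leb_tuple m]_t \prod_(i < m) F i (tnth t i) =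
  \prod_(i < m) \int[lebesgue_measure]_x F i x.
Proof.
elim: m F => [|m IH] F mF F0.
  rewrite big_ord0 /=; under eq_integral do rewrite big_ord0.
  by rewrite integral_dirac// diracT mul1e.
have mprod n (G : 'I_n -> R -> \bar R) :
    (forall i, measurable_fun setT (G i)) ->
    measurable_fun setT (fun t : n.-tuple R => \prod_(i < n) G i (tnth t i)).
  move=> mG; apply: emeasurable_prod => i.
  by apply: measurableT_comp => //; exact: measurable_tnth.
rewrite /= ge0_integral_pushforward//; last 3 first.
- exact: measurable_tuple_cons.
- exact: mprod.
- by move=> t _; exact: prode_ge0.
rewrite preimage_setT.
transitivity (\int[lebesgue_measure \x leb_tuple m]_p
    (F ord0 p.1 * \prod_(i < m) F (lift ord0 i) (tnth p.2 i))).
  apply: eq_integral => -[x t] _ /=; rewrite big_ord_recl.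
  congr (_ * _); apply: eq_bigr => i _.
  by rewrite -[in RHS](tnthS x t).
rewrite fubini_tonelli1; last 2 first.
- apply: emeasurable_funM; first exact: (measurableT_comp (mF ord0)).
  exact: (measurableT_comp (mprod _ _ (fun i => mF (lift ord0 i)))).
- by move=> p; rewrite mule_ge0// prode_ge0.
rewrite big_ord_recl -IH//.
rewrite -ge0_integralZr//; last first.
- by apply: integral_ge0 => t _; exact: prode_ge0.
- exact: mF.
apply: eq_integral => x _; rewrite /fubini_F/= ge0_integralZl//.
- exact: (mprod _ (fun i => F (lift ord0 i))).
- by move=> t _; exact: prode_ge0.
Qed.

Definition tensor (K : R -> R -> \bar R) m (s t : m.-tuple R) : \bar R :=
  \prod_(i < m) K (tnth s i) (tnth t i).

Lemma tensor_ge0 K m (s t : m.-tuple R) : (forall x y, 0 <= K x y) ->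
  0 <= tensor K s t.
Proof. by move=> K0; exact: prode_ge0. Qed.

Lemma measurable_tensor K m : measurable_fun2 K ->
  measurable_fun2 (@tensor K m).
Proof.
move=> mK; apply: (@emeasurable_prod _ _ 'I_m _
    (fun i (p : m.-tuple R * m.-tuple R) => K (tnth p.1 i) (tnth p.2 i))) => i.
apply: (measurable_fun2_comp mK).
  exact: (measurableT_comp (measurable_tnth i) measurable_fst).
exact: (measurableT_comp (measurable_tnth i) measurable_snd).
Qed.

(** The constant of a one-dimensional comparison is paid once per
    coordinate. *)
Lemma tensor_le (c : R) (K L : R -> R -> \bar R) m (s t : m.-tuple R) :
  (0 <= c)%R -> (forall x y, 0 <= K x y) -> (forall x y, 0 <= L x y) ->
  (forall i, K (tnth s i) (tnth t i) <= c%:E * L (tnth s i) (tnth t i)) ->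
  tensor K s t <= (c ^+ m)%:E * tensor L s t.
Proof.
move=> c0 K0 L0; elim: m s t => [|m IH] s t KL.
  by rewrite /tensor !big_ord0 expr0 mule1.
rewrite /tensor !big_ord_recl exprS EFinM muleACA.
apply: lee_pmul => //; first exact: prode_ge0.
case/tupleP: s KL => x s; case/tupleP: t => y t KL.
under eq_bigr do rewrite !tnthS.
under [X in _ <= _ * X]eq_bigr do rewrite !tnthS.
by apply: IH => i; have := KL (lift ord0 i); rewrite !tnthS.
Qed.

Lemma integral_tensorM (K L : R -> R -> \bar R) m (s u : m.-tuple R) :
  measurable_fun2 K -> measurable_fun2 L ->
  (forall x y, 0 <= K x y) -> (forall x y, 0 <= L x y) ->
  \int[leb_tuple m]_t (tensor K s t * tensor L t u) =
  tensor (fun x z => \int[lebesgue_measure]_y (K x y * L y z)) s u.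
Proof.
move=> mK mL K0 L0.
rewrite /tensor -integral_leb_tuple_prod.
- by apply: eq_integral => t _; rewrite -big_split.
- move=> i; apply: emeasurable_funM; first exact: (measurable_fun2l _ mK).
  exact: (measurable_fun2r _ mL).
- by move=> i x; rewrite mule_ge0.
Qed.

Lemma integral_tensor (K : R -> R -> \bar R) m (s : m.-tuple R) :
  measurable_fun2 K -> (forall x y, 0 <= K x y) ->
  (forall x, \int[lebesgue_measure]_y K x y = 1) ->
  \int[leb_tuple m]_t tensor K s t = 1.
Proof.
move=> mK K0 K1; rewrite /tensor.
rewrite (integral_leb_tuple_prod (F := fun i => K (tnth s i)))//.
  by rewrite big1.
by move=> i; exact: (measurable_fun2l _ mK).
Qed.

Lemma tensorC K m (s t : m.-tuple R) :
  tensor K s t = tensor (fun x y => K y x) t s.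
Proof. by []. Qed.

Definition diagonal_set m (s : m.-tuple R) : set (m.-tuple R) :=
  [set t | exists i, tnth s i = tnth t i].

(** By induction on m: either the first coordinates agree, which confines t to
    a hyperplane, or the tails meet the diagonal in dimension m. *)
Lemma negligible_diagonal m (s : m.-tuple R) :
  (leb_tuple m).-negligible (diagonal_set s).
Proof.
elim: m s => [|m IH] s.
  by exists set0; split => // t [[]].
case/tupleP: s => x s; have [B [mB B0 sB]] := IH s.
have box (A : set R) (C : set (m.-tuple R)) : measurable A -> measurable C ->
    measurable [set t : m.+1.-tuple R | A (thead t) /\ C [tuple of behead t]].
  move=> mA mC; apply: measurableI.
    have : measurable_fun [set: m.+1.-tuple R] (fun t => tnth t ord0).
      exact: measurable_tnth.
    by move=> /(_ measurableT _ mA); rewrite setTI.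
  by have := @measurable_behead _ R m measurableT _ mC; rewrite setTI.
exists ([set t | [set x] (thead t) /\ setT [tuple of behead t]] `|`
  [set t | setT (thead t) /\ B [tuple of behead t]]); split.
- by apply: measurableU; exact: box.
- apply/eqP; rewrite eq_le measure_ge0 andbT.
  apply: le_trans (measureU2 _ _ _) _; [exact: box|exact: box|].
  have := leb_consE (leb_tuple m) (measurable_set1 x) measurableT.
  have := leb_consE (leb_tuple m) measurableT mB.
  rewrite lebesgue_measure_set1 mul0e [leb_tuple m B]B0 mule0 => E1 E2.
  by rewrite [X in X + _]E2 [X in _ + X]E1 adde0.
- case/tupleP => y t [i]; rewrite /= !theadE.
  case: (unliftP ord0 i) => [j|] ->; last by left.
  rewrite !tnthS => st; right; split => //.
  rewrite (_ : [tuple of behead [tuple of y :: t]] = t); last exact: val_inj.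
  by apply: sB; exists j.
Qed.

End tensor.
Arguments tensor {R} K {m} s t.

(** * The Riesz kernel on the line *)

Section riesz.
Context {R : realType}.
Implicit Types (g r s t u : R).

Lemma ler_powRN g x y : 0 <= g -> 0 < x -> x <= y -> y `^ (- g) <= x `^ (- g).
Proof.
move=> g0 x0 xy; have y0 : 0 < y by exact: lt_le_trans xy.
rewrite !powRN lef_pV2 ?posrE ?powR_gt0//.
by apply: ge0_ler_powR => //; rewrite nnegrE ltW.
Qed.

Lemma exp2_unbounded (y : R) : exists n : nat, y <= 2 ^+ n.
Proof.
exists (Num.trunc y).+1; apply: le_trans (ltW (truncnS_gt y)) _.
by rewrite -natrX ler_nat ltnW// ltn_expl.
Qed.

Lemma powR_exprn x g n : 0 <= x -> (x ^+ n) `^ g = (x `^ g) ^+ n.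
Proof.
move=> x0; rewrite -(powR_mulrn n x0) -powRrM mulrC powRrM.
exact: powR_mulrn (powR_ge0 _ _).
Qed.

Lemma powRN_mul g x : 0 < x -> x `^ (- g) * x = x `^ (1 - g).
Proof.
move=> x0; have xN0 : x != 0 by rewrite gt_eqF.
by rewrite [1 - g]addrC powRD ?xN0 ?implybT// powRr1// ltW.
Qed.

Lemma measurable_dist_powR g s :
  measurable_fun [set: R] (fun t => (`|s - t| `^ (- g))%:E).
Proof.
apply/measurable_EFinP; apply: (measurableT_comp (measurable_powR _)).
by apply: measurableT_comp => //; exact: measurable_funB.
Qed.

(** Dyadic summation. The set D is covered, up to the point s, by the annuli
    a q^n <= |s - t| <= 2 a q^n; such an annulus lies in an interval of length
    4 a q^n, on which the integrand is at most (a q^n)^(-g) within D. The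
    contributions 4 (a q^n)^(1 - g) form a geometric series. *)
Lemma integral_dist_powR_le g s (q a : R) (D : set R) :
  0 <= g -> 0 < q -> 0 < a -> q `^ (1 - g) < 1 ->
  (forall t, D t -> t != s ->
    exists n, a * q ^+ n <= `|s - t| <= 2 * (a * q ^+ n)) ->
  (\int[lebesgue_measure]_(t in D) (`|s - t| `^ (- g))%:E <=
    (4 / (1 - q `^ (1 - g)) * a `^ (1 - g))%:E)%E.
Proof.
move=> g0 q0 a0 q1 Dn.
pose r n := a * q ^+ n.
have r0 n : 0 < r n by rewrite mulr_gt0// exprn_gt0.
pose A n := `[s - 2 * r n, s + 2 * r n]%classic.
pose u n t : \bar R := ((r n `^ (- g))%:E * (\1_(A n) t)%:E)%E.
have mA n : measurable (A n) by exact: measurable_itv.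
have mu n : measurable_fun [set: R] (u n).
  apply: emeasurable_funM => //.
  by apply/measurable_EFinP; exact: measurable_indic.
have u0 n t : (0 <= u n t)%E by rewrite mule_ge0// lee_fin ?powR_ge0.
apply: (@le_trans _ _ (\int[lebesgue_measure]_t
    ((\1_[set s] t)%:E + \sum_(n <oo) u n t)))%E.
  rewrite integral_mkcond; apply: ge0_le_integral_nonmeas => t _.
    by apply: erestrict_ge0 => x _; rewrite lee_fin powR_ge0.
  rewrite patchE; case: ifPn => [/set_mem Dt|_]; last first.
    by rewrite adde_ge0 ?nneseries_ge0// lee_fin.
  have [->|ts] := eqVneq t s.
    rewrite subrr normr0 indicE mem_set//.
    apply: (@le_trans _ _ 1%E); last by rewrite leeDl ?nneseries_ge0.
    rewrite lee_fin; have [->|gN0] := eqVneq (- g) 0; first by rewrite powRr0.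
    by rewrite powR0.
  have [n /andP[nl nu]] := Dn _ Dt ts.
  apply: (@le_trans _ _ (u n t)).
    rewrite /u indicE mem_set ?mule1 ?lee_fin; first exact: ler_powRN.
    move: nu; rewrite -/(r n) /A /= in_itv/= ler_norml => /andP[h1 h2].
    by apply/andP; split; lra.
  apply: (@le_trans _ _ (\sum_(0 <= i < n.+1) u i t)%E).
    by rewrite big_nat_recr//= leeDr// sume_ge0.
  apply: (@le_trans _ _ (\sum_(n <oo) u n t)%E).
    exact: nneseries_lim_ge.
  by rewrite leeDr// lee_fin.
have m1 : measurable_fun [set: R] (fun t => (\1_[set s] t)%:E : \bar R).
  by apply/measurable_EFinP; exact: measurable_indic.
have mS : measurable_fun [set: R] (fun t => \sum_(n <oo) u n t)%E.
  exact: ge0_emeasurable_sum.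
rewrite ge0_integralD//; last by move=> t _; exact: nneseries_ge0.
rewrite integral_indic// setIT [X in (X + _)%E](lebesgue_measure_set1 s) add0e.
rewrite integral_nneseries//.
apply: lime_le; first by apply: is_cvg_nneseries => n _ _; exact: integral_ge0.
apply: nearW => N.
have -> : (\sum_(0 <= n < N) \int[lebesgue_measure]_t u n t =
    (series (geometric (4 * a `^ (1 - g)) (q `^ (1 - g))) N)%:E)%E.
  rewrite /series/= -sumEFin; apply: eq_bigr => n _.
  have mAn : measurable_fun [set: R] (fun t => (\1_(A n) t)%:E : \bar R).
    by apply/measurable_EFinP; exact: measurable_indic.
  rewrite ge0_integralZl//; last by rewrite lee_fin powR_ge0.
  have lA : lebesgue_measure (A n) = (4 * r n)%:E.
    rewrite lebesgue_measure_itv/= lte_fin ifT; last by have := r0 n; lra.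
    by rewrite -EFinD; congr EFin; ring.
  rewrite integral_indic//; last exact: mA.
  rewrite setIT [X in (_ * X)%E]lA -EFinM; congr EFin.
  rewrite mulrCA powRN_mul//.
  rewrite /r powRM ?exprn_ge0 ?(ltW a0) ?(ltW q0)//.
  by rewrite powR_exprn ?(ltW q0)// mulrA.
rewrite lee_fin.
apply: le_trans (geometric_le_lim _ _ _ _) _.
- by rewrite mulr_ge0// powR_ge0.
- exact: powR_gt0.
- by rewrite ger0_norm ?powR_ge0.
- by rewrite mulrAC.
Qed.

(** Integrability at the singularity: shrinking annuli, q = 1/2 and a =
    r/2. *)
Lemma integral_dist_powR_near g : 0 <= g -> g < 1 ->
  exists2 C : R, 0 <= C & forall s r, 0 < r ->
  (\int[lebesgue_measure]_(t in [set t | (`|s - t| <= r)%R])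
      (`|s - t| `^ (- g))%:E <= (C * r `^ (1 - g))%:E)%E.
Proof.
move=> g0 g1; have q1 : 2^-1 `^ (1 - g) < 1 :> R.
  apply: (@lt_le_trans _ _ (1 `^ (1 - g))); last by rewrite powR1.
  by apply: gt0_ltr_powR; rewrite ?nnegrE ?subr_gt0 ?invr_ge0//; lra.
exists (4 / (1 - 2^-1 `^ (1 - g)) * 2^-1 `^ (1 - g)).
  by rewrite mulr_ge0 ?powR_ge0// divr_ge0// subr_ge0 ltW.
move=> s r r0; apply: le_trans
  (@integral_dist_powR_le g s 2^-1 (r * 2^-1) _ g0 _ _ q1 _) _ => //.
- by rewrite divr_gt0.
- move=> t /= tr ts.
  have st0 : 0 < `|s - t| by rewrite normr_gt0 subr_eq0 eq_sym.
  have ex : exists n : nat, r * 2^-1 * 2^-1 ^+ n <= `|s - t|.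
    have [n nP] := exp2_unbounded (r * 2^-1 / `|s - t|); exists n.
    by rewrite exprVn ler_pdivrMr ?exprn_gt0// [leRHS]mulrC -ler_pdivrMr.
  case: (ex_minnP ex) => n nP nmin; exists n; rewrite nP/=.
  case: n nP nmin => [|n] _ nmin; first by rewrite expr0; lra.
  have : ~~ (r * 2^-1 * 2^-1 ^+ n <= `|s - t|).
    by apply/negP => /nmin; rewrite ltnn.
  by rewrite -ltNge exprS; lra.
- rewrite powRM ?invr_ge0 ?(ltW r0)// lee_fin le_eqVlt; apply/orP; left.
  by apply/eqP; ring.
Qed.

(** Integrability at infinity: growing annuli, q = 2 and a = r. *)
Lemma integral_dist_powR_far g : 1 < g ->
  exists2 C : R, 0 <= C & forall s r, 0 < r ->
  (\int[lebesgue_measure]_(t in [set t | (r <= `|s - t|)%R])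
      (`|s - t| `^ (- g))%:E <= (C * r `^ (1 - g))%:E)%E.
Proof.
move=> g1; have q1 : 2 `^ (1 - g) < 1 :> R.
  rewrite -opprB powRN invf_lt1 ?powR_gt0//.
  apply: (@le_lt_trans _ _ (1 `^ (g - 1))); first by rewrite powR1.
  by apply: gt0_ltr_powR; rewrite ?nnegrE ?subr_gt0//; lra.
exists (4 / (1 - 2 `^ (1 - g))).
  by rewrite divr_ge0// subr_ge0 ltW.
move=> s r r0; apply: le_trans
  (@integral_dist_powR_le g s 2 r _ _ _ r0 q1 _) _ => //; first by lra.
move=> t /= tr ts.
have ex : exists n : nat, `|s - t| <= 2 * (r * 2 ^+ n).
  have [n nP] := exp2_unbounded (`|s - t| / r); exists n.
  move: nP; rewrite ler_pdivrMr//; set x := 2 ^+ n.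
  have : 0 < x * r by rewrite mulr_gt0// exprn_gt0.
  by lra.
case: (ex_minnP ex) => n nP nmin; exists n; rewrite nP andbT.
case: n nP nmin => [|n] _ nmin; first by rewrite expr0 mulr1.
have : ~~ (`|s - t| <= 2 * (r * 2 ^+ n)).
  by apply/negP => /nmin; rewrite ltnn.
by rewrite -ltNge exprS; lra.
Qed.

End riesz.

Section riesz_kernel.
Local Open Scope ereal_scope.
Context {R : realType}.
Implicit Types (al s t u : R).

(** On the diagonal the value is that of 0 `^ (- al), that is 1 if al = 0 and
    0 otherwise, in accordance with [Bkernel]. *)
Definition riesz al s t : \bar R := (`|s - t| `^ (- al))%:E.

Lemma riesz_ge0 al s t : 0 <= riesz al s t.
Proof. by rewrite lee_fin powR_ge0. Qed.

Lemma rieszC al s t : riesz al s t = riesz al t s.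
Proof. by rewrite /riesz distrC. Qed.

Lemma measurable_riesz al : measurable_fun2 (riesz al).
Proof.
apply/measurable_EFinP; apply: (measurableT_comp (measurable_powR _)).
by apply: measurableT_comp => //; exact: measurable_funB.
Qed.

(** Let r = |s - t| / 2. Within distance r of one of the two points, the
    factor that is singular at the other one is at most r^(-g), and the
    remaining factor is integrable because g < 1. Farther away from both, the
    product is at most the sum of the squares, integrable at infinity because
    2 g > 1. All contributions scale as r^(1 - 2 g) = r^(-al). *)
Lemma riesz_feature_le al (g := ((1 + al) / 2)%R) : (0 < al < 1)%R ->
  exists2 C : R, (0 <= C)%R & forall s t, s <> t ->
  \int[lebesgue_measure]_u (riesz g s u * riesz g t u) <= C%:E * riesz al s t.
Proof.
move=> /andP[al0 al1]; have g1 : (g < 1)%R by rewrite /g; lra.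
have g0 : (0 <= g)%R by rewrite /g; lra.
have gg1 : (1 < g + g)%R by rewrite /g; lra.
have [C1 C10 near] := integral_dist_powR_near g0 g1.
have [C2 C20 far] := integral_dist_powR_far gg1.
exists ((C1 + C2) * 2 * 2^-1 `^ (- al))%R.
  by rewrite !mulr_ge0// ?addr_ge0// powR_ge0.
move=> s t /eqP st; pose r := (`|s - t| / 2)%R.
have r0 : (0 < r)%R by rewrite divr_gt0// normr_gt0 subr_eq0.
pose N s u := ((fun u => (`|s - u| `^ (- g))%:E) \_
  [set u | (`|s - u| <= r)%R]) u.
pose F s u := ((fun u => (`|s - u| `^ (- (g + g)))%:E) \_
  [set u | (r <= `|s - u|)%R]) u.
have N0 x u : 0 <= N x u by apply: erestrict_ge0 => *; rewrite lee_fin powR_ge0.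
have F0 x u : 0 <= F x u by apply: erestrict_ge0 => *; rewrite lee_fin powR_ge0.
have mdist x : measurable_fun [set: R] (fun u => `|x - u|)%R.
  by apply: measurableT_comp => //; exact: measurable_funB.
have mN x : measurable_fun [set: R] (N x).
  apply/(measurable_restrictT _ _).1.
    have := mdist x measurableT _ (measurable_itv `]-oo, r]).
    by rewrite setTI; congr (measurable _); apply/seteqP; split => u /=;
      rewrite in_itv.
  by apply: measurable_funTS; exact: measurable_dist_powR.
have mF x : measurable_fun [set: R] (F x).
  apply/(measurable_restrictT _ _).1.
    have := mdist x measurableT _ (measurable_itv `[r, +oo[).
    by rewrite setTI; congr (measurable _); apply/seteqP; split => u /=;
      rewrite in_itv/= andbT.
  by apply: measurable_funTS; exact: measurable_dist_powR.
pose c := (r `^ (- g))%:E.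
have c0 : 0 <= c by rewrite lee_fin powR_ge0.
have pointwise u : riesz g s u * riesz g t u <=
    (c * N s u + F s u) + (c * N t u + F t u).
  have P x y : (`|x - u| <= r)%R -> (r <= `|y - u|)%R ->
      riesz g x u * riesz g y u <= c * N x u.
    move=> xr yr; rewrite /N patchE mem_set//= muleC.
    by apply: lee_wpmul2r; [exact: riesz_ge0|rewrite lee_fin; exact: ler_powRN].
  have tri : (r + r <= `|s - u| + `|t - u|)%R.
    have := ler_distD u s t; rewrite [`|u - t|%R]distrC /r; lra.
  have [sr|sr] := leP `|s - u|%R r.
    have tr : (r <= `|t - u|)%R by lra.
    apply: le_trans (P _ _ sr tr) _.
    by rewrite -addeA leeDl// !adde_ge0// mule_ge0.
  have [tr|tr] := leP `|t - u|%R r.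
    rewrite muleC; apply: le_trans (P _ _ tr (ltW sr)) _.
    by rewrite addeCA leeDl// !adde_ge0// mule_ge0.
  apply: (@le_trans _ _ (F s u + F t u)); last first.
    by apply: leeD; rewrite leeDr// mule_ge0.
  rewrite /F !patchE !mem_set/= ?(ltW sr) ?(ltW tr)//.
  rewrite /riesz -EFinM -EFinD lee_fin !opprD.
  have pD x : (r < `|x - u|)%R -> (`|x - u| `^ (- g - g) =
      `|x - u| `^ (- g) * `|x - u| `^ (- g))%R.
    move=> xr; rewrite powRD// [X in _ ==> ~~ X]gt_eqF ?implybT//.
    exact: lt_trans xr.
  rewrite (pD _ sr) (pD _ tr).
  have := powR_ge0 `|s - u|%R (- g); have := powR_ge0 `|t - u|%R (- g).
  move: (_ `^ _)%R (_ `^ _)%R => x y x0 y0.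
  have := sqr_ge0 (x - y)%R; nra.
apply: (@le_trans _ _ (\int[lebesgue_measure]_u
    ((c * N s u + F s u) + (c * N t u + F t u)))).
  apply: ge0_le_integral_nonmeas => u _; last exact: pointwise.
  by rewrite mule_ge0// riesz_ge0.
have half x : \int[lebesgue_measure]_u (c * N x u + F x u) <=
    ((C1 + C2) * r `^ (- al))%:E.
  have cN0 u : 0 <= c * N x u by rewrite mule_ge0.
  have mcN : measurable_fun [set: R] (fun u => c * N x u).
    exact: emeasurable_funM.
  rewrite ge0_integralD//; last exact: mF.
  have nearN : \int[lebesgue_measure]_u N x u <= (C1 * r `^ (1 - g))%:E.
    by have := near x r r0; rewrite integral_mkcond.
  have farF : \int[lebesgue_measure]_u F x u <= (C2 * r `^ (1 - (g + g)))%:E.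
    by have := far x r r0; rewrite integral_mkcond.
  rewrite ge0_integralZl//; last exact: mN.
  rewrite mulrDl EFinD.
  have e : (1 - (g + g) = - al)%R by rewrite /g; lra.
  apply: leeD; last by rewrite -e.
  apply: (@le_trans _ _ (c * (C1 * r `^ (1 - g))%:E)).
    by exact: lee_wpmul2l.
  rewrite -EFinM lee_fin mulrCA -powRD; last by rewrite (gt_eqF r0) implybT.
  by rewrite (_ : (- g + (1 - g) = - al)%R)// -e; ring.
have mS x : measurable_fun [set: R] (fun u => c * N x u + F x u).
  by apply: emeasurable_funD => //; exact: emeasurable_funM.
have S0 x u : 0 <= c * N x u + F x u by rewrite adde_ge0// mule_ge0.
rewrite ge0_integralD//; [|exact: mS|exact: mS].
apply: le_trans (leeD (half s) (half t)) _.
rewrite -EFinD -EFinM lee_fin /r powRM ?invr_ge0//.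
by rewrite le_eqVlt; apply/orP; left; apply/eqP; ring.
Qed.

(** For u between s and t both factors are at least |s - t|^(-g), and these u
    form an interval of length |s - t|; moreover 1 - 2 g = - al. *)
Lemma riesz_le_feature al (g := ((1 + al) / 2)%R) s t : (0 < al < 1)%R ->
  riesz al s t <= \int[lebesgue_measure]_u (riesz g s u * riesz g t u).
Proof.
move=> /andP[al0 al1].
have [->|] := eqVneq s t.
  rewrite {1}/riesz subrr normr0 powR0 ?oppr_eq0 ?gt_eqF//.
  by apply: integral_ge0 => u _; rewrite mule_ge0// riesz_ge0.
wlog st : s t / (s < t)%R.
  move=> W; case: (ltgtP s t) => // st _.
    by apply: W => //; rewrite lt_eqF.
  rewrite rieszC; under eq_integral do rewrite muleC.
  by apply: W => //; rewrite lt_eqF.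
move=> _; have g0 : (0 <= g)%R by rewrite /g; lra.
pose d := `|s - t|%R.
have dE : d = (t - s)%R by rewrite /d distrC gtr0_norm// subr_gt0.
have d0 : (0 < d)%R by rewrite dE subr_gt0.
pose c := (d `^ (- g) * d `^ (- g))%R.
have m1 : measurable_fun [set: R] (fun u => (\1_`]s, t[%classic u)%:E : \bar R).
  by apply/measurable_EFinP; exact: measurable_indic.
apply: (@le_trans _ _
    (\int[lebesgue_measure]_u (c%:E * (\1_`]s, t[%classic u)%:E))).
  rewrite ge0_integralZl//; last by rewrite lee_fin mulr_ge0 ?powR_ge0.
  rewrite integral_indic; last 2 first.
  - exact: measurableT.
  - exact: measurable_itv.
  have ld : lebesgue_measure (`]s, t[%classic : set R) = d%:E.
    by rewrite lebesgue_measure_itv/= lte_fin st dE -EFinD.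
  rewrite setIT [X in _ * X]ld -EFinM lee_fin /c -powRD; last first.
    by rewrite (gt_eqF d0) implybT.
  rewrite (_ : (- g + - g = - (g + g))%R); last by ring.
  by rewrite powRN_mul// (_ : (1 - (g + g) = - al)%R)// /g; lra.
apply: ge0_le_integral_nonmeas => /= u _.
  by rewrite mule_ge0// lee_fin// mulr_ge0 ?powR_ge0.
rewrite indicE; have [/set_mem|] := boolP (u \in _); last first.
  by rewrite mule0 mule_ge0// riesz_ge0.
rewrite /= in_itv/= => /andP[su ut]; rewrite mule1 /riesz -EFinM lee_fin.
rewrite (distrC s) (gtr0_norm (x := (u - s)%R)) ?subr_gt0//.
rewrite (gtr0_norm (x := (t - u)%R)) ?subr_gt0//.
apply: ler_pM; rewrite ?powR_ge0//; apply: ler_powRN => //;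
  rewrite ?subr_gt0 ?dE//; lra.
Qed.

(** The Riesz kernel is comparable with a Gram kernel, a quantitative
    substitute for its positive definiteness. For al = 0 it is the constant 1,
    for which the feature |s - u|^(-1/2) is not square integrable; the
    indicator of [0, 1] as a function of u, whatever s, has Gram kernel 1. *)
Lemma riesz_feature al : (0 <= al < 1)%R ->
  exists (phi : R -> R -> \bar R) (c1 c2 : R),
  [/\ (0 <= c1)%R, (0 <= c2)%R, measurable_fun2 phi &
      (forall s u, 0 <= phi s u)] /\
  [/\ (forall s t, riesz al s t <=
         c1%:E * \int[lebesgue_measure]_u (phi s u * phi t u)) &
      (forall s t, s <> t -> \int[lebesgue_measure]_u (phi s u * phi t u) <=
         c2%:E * riesz al s t)].
Proof.
move=> /andP[]; rewrite le_eqVlt => /predU1P[<- _|al0 al1].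
  exists (fun s u => (\1_`[0%R, 1%R]%classic u)%:E), 1%R, 1%R.
  have m01 : measurable (`[0%R, 1%R]%classic : set R) by exact: measurable_itv.
  have I1 : \int[lebesgue_measure]_u
      ((\1_(`[0%R, 1%R]%classic : set R) u)%:E *
       (\1_(`[0%R, 1%R]%classic : set R) u)%:E) = 1%E :> \bar R.
    transitivity
      (\int[lebesgue_measure]_u (\1_(`[0%R, 1%R]%classic : set R) u)%:E).
      apply: eq_integral => u _.
      by rewrite -EFinM indicE; case: (_ \in _); rewrite ?mulr1 ?mulr0.
    rewrite integral_indic; [|exact: measurableT|exact: measurable_itv].
    have l1 : lebesgue_measure (`[0%R, 1%R]%classic : set R) = 1 :> \bar R.
      by rewrite lebesgue_measure_itv/= lte_fin ltr01 -EFinD subr0.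
    by rewrite setIT [LHS]l1.
  split; split => //.
  - have mf : measurable_fun [set: R]
        (fun u => (\1_`[0%R, 1%R]%classic u)%:E : \bar R).
      by apply/measurable_EFinP; exact: measurable_indic.
    exact: (measurableT_comp mf (measurable_snd (T1 := R) (T2 := R))).
  - by move=> s t; rewrite I1 mul1e lee_fin oppr0 powRr0.
  - by move=> s t _; rewrite I1 mul1e lee_fin oppr0 powRr0.
have al01 : (0 < al < 1)%R by rewrite al0.
have [C C0 hC] := riesz_feature_le al01.
exists (riesz ((1 + al) / 2)), 1%R, C; split; split => //.
- exact: measurable_riesz.
- by move=> s u; exact: riesz_ge0.
- by move=> s t; rewrite mul1e; exact: riesz_le_feature.
Qed.

(** Here a plays the role of the average over cells of diameter 1 / lam.
    Moving s' and t' inside their cells changes d = |s' - t'| by at most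
    2 / lam. If d >= 4 / lam, distances stay above d / 2, so the kernel grows
    by a factor 2^al at most. If d < 4 / lam, distances stay below 6 / lam,
    and the integral of the kernel over that range, times the density lam, is
    of order lam^al, which is at most (4 / d)^al. *)
Lemma riesz_cell_mean al : (0 <= al < 1)%R ->
  exists2 C : R, (0 <= C)%R & forall (lam : R) (a : R -> R -> \bar R),
    (0 < lam)%R -> measurable_fun2 a ->
    (forall s s', 0 <= a s s' <= lam%:E) ->
    (forall s s', a s s' != 0 -> (`|s - s'| <= lam^-1)%R) ->
    (forall s', \int[lebesgue_measure]_s a s s' = 1) ->
    forall s' t', s' <> t' ->
    \int[lebesgue_measure]_s
      ((\int[lebesgue_measure]_t (riesz al s t * a t t')) * a s s')
    <= C%:E * riesz al s' t'.
Proof.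
move=> /andP[al0 al1].
have [C1 C10 near] := integral_dist_powR_near al0 al1.
exists (2^-1 `^ (- al) + C1 * 6 `^ (1 - al) * 4^-1 `^ (- al))%R.
  by rewrite addr_ge0 ?mulr_ge0 ?powR_ge0.
move=> lam a lam0 ma a01 alam a1 s' t' /eqP st'.
have a0 s t : 0 <= a s t by have /andP[] := a01 s t.
have dl0 : (0 < lam^-1)%R by rewrite invr_gt0.
pose d := `|s' - t'|%R.
have d0 : (0 < d)%R by rewrite normr_gt0 subr_eq0.
have mar x : measurable_fun setT (a ^~ x) by exact: measurable_fun2r ma.
have ra0 s t x : 0 <= riesz al s t * a t x by rewrite mule_ge0// riesz_ge0.
have inner s : (\int[lebesgue_measure]_t (riesz al s t * a t t')) * a s s' <=
    (2^-1 `^ (- al) + C1 * 6 `^ (1 - al) * 4^-1 `^ (- al))%:E * riesz al s' t' *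
    a s s'.
  have [->|ass'] := eqVneq (a s s') 0; first by rewrite !mule0.
  apply: lee_wpmul2r => //; have ss' := alam _ _ ass'.
  have tri t : (d <= `|s - s'| + `|s - t| + `|t - t'|)%R.
    rewrite /d distrC.
    have := ler_distD s t' s'; have := ler_distD t s t'.
    by rewrite (distrC t' s') (distrC t' s); lra.
  rewrite EFinD ge0_muleDl ?lee_fin ?mulr_ge0 ?powR_ge0//.
  have [dbig|dsmall] := leP (4 * lam^-1)%R d.
    apply: (@le_trans _ _ ((2^-1 `^ (- al))%:E * riesz al s' t')); last first.
      by rewrite leeDl// mule_ge0 ?riesz_ge0// lee_fin !mulr_ge0 ?powR_ge0.
    have c0 : 0 <= (2^-1 `^ (- al))%:E * riesz al s' t'.
      by rewrite mule_ge0 ?riesz_ge0// lee_fin powR_ge0.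
    rewrite -[leRHS]mule1 -(a1 t') -ge0_integralZl//; last exact: mar.
    apply: ge0_le_integral_nonmeas => //= t _.
    have [->|att'] := eqVneq (a t t') 0; first by rewrite !mule0.
    apply: lee_wpmul2r => //; have tt' := alam _ _ att'.
    rewrite /riesz -EFinM lee_fin -powRM ?invr_ge0//.
    apply: ler_powRN => //; first by rewrite mulr_gt0// invr_gt0.
    by have := tri t; rewrite -/d; lra.
  apply: (@le_trans _ _
     ((C1 * 6 `^ (1 - al) * 4^-1 `^ (- al))%:E * riesz al s' t')); last first.
    by rewrite leeDr// mule_ge0 ?riesz_ge0// lee_fin powR_ge0.
  apply: (@le_trans _ _ (lam%:E * \int[lebesgue_measure]_(t in
       [set t | (`|s - t| <= 6 * lam^-1)%R]) (`|s - t| `^ (- al))%:E)).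
    pose f := (fun t => (`|s - t| `^ (- al))%:E) \_
      [set t | (`|s - t| <= 6 * lam^-1)%R].
    have f0 t : 0 <= f t by apply: erestrict_ge0 => *; rewrite lee_fin powR_ge0.
    have mf : measurable_fun [set: R] f.
      apply/(measurable_restrictT _ _).1.
        have : measurable_fun [set: R] (fun u => `|s - u|)%R.
          by apply: measurableT_comp => //; exact: measurable_funB.
        move=> /(_ measurableT _ (measurable_itv `]-oo, (6 * lam^-1)%R])).
        by rewrite setTI; congr (measurable _); apply/seteqP; split => u /=;
          rewrite in_itv.
      by apply: measurable_funTS; exact: measurable_dist_powR.
    rewrite [X in _ <= _ * X]integral_mkcond -/f -ge0_integralZl//; last first.
      by rewrite lee_fin ltW.
    apply: ge0_le_integral_nonmeas => //= t _.
    have [->|att'] := eqVneq (a t t') 0.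
      by rewrite mule0 mule_ge0 ?lee_fin ?(ltW lam0).
    rewrite /f patchE mem_set; last first.
      have tt' := alam _ _ att'.
      have := ler_distD s' s t; have := ler_distD t' s' t.
      rewrite /= (distrC t' t) -/d; lra.
    rewrite muleC; apply: lee_wpmul2r; first exact: riesz_ge0.
    by have /andP[] := a01 t t'.
  have l60 : (0 < 6 * lam^-1)%R by rewrite mulr_gt0.
  apply: le_trans (lee_wpmul2l _ (near s _ l60)) _.
    by rewrite lee_fin ltW.
  rewrite -EFinM /riesz -EFinM lee_fin.
  rewrite powRM ?(ltW dl0)// mulrCA -!mulrA; apply: ler_wpM2l => //.
  rewrite mulrCA; apply: ler_wpM2l; first exact: powR_ge0.
  rewrite -powRM ?invr_ge0//; apply: (@le_trans _ _ (lam^-1 `^ (- al))%R).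
    by rewrite -powRN_mul// mulrCA divff ?mulr1// gt_eqF.
  apply: ler_powRN => //; last by rewrite -/d; lra.
  by rewrite mulr_gt0// invr_gt0.
apply: (@le_trans _ _ (\int[lebesgue_measure]_s
    ((2^-1 `^ (- al) + C1 * 6 `^ (1 - al) * 4^-1 `^ (- al))%:E *
     riesz al s' t' * a s s'))).
  apply: ge0_le_integral_nonmeas => s _; last exact: inner.
  by rewrite mule_ge0// integral_ge0.
rewrite ge0_integralZl//.
- by rewrite [X in _ * X]a1 mule1.
- exact: mar.
- by rewrite mule_ge0 ?riesz_ge0// lee_fin addr_ge0 ?mulr_ge0 ?powR_ge0.
Qed.

End riesz_kernel.

(** * Block averaging of energies *)

Section cells.
Context {R : realType}.

(** The level sets of c are intervals of length 1 / lam. Time cells are open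
    on the left and space cells on the right; this predicate covers both. *)
Definition grid (lam : R) (c : R -> int) := forall i : int,
  exists J : interval R, [/\ c @^-1` [set i] = [set` J],
    lebesgue_measure ([set` J] : set R) = (lam^-1)%:E &
    forall x y, x \in J -> y \in J -> `|x - y| <= lam^-1].

Lemma ceilEitv (lam s : R) (i : int) : 0 < lam ->
  (Num.ceil (lam * s) = i) <-> (i - 1)%:~R / lam < s <= i%:~R / lam.
Proof.
move=> lam0; rewrite ltr_pdivrMr// ler_pdivlMr// mulrC.
by split => [<-|]; [exact: ceil_itv|exact: ceil_def].
Qed.

Lemma floorEitv (lam s : R) (i : int) : 0 < lam ->
  (Num.floor (lam * s) = i) <-> i%:~R / lam <= s < (i + 1)%:~R / lam.
Proof.
move=> lam0; rewrite ler_pdivrMr// ltr_pdivlMr// mulrC.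
by split => [<-|]; [exact: floor_itv|exact: floor_def].
Qed.

Lemma grid_ceil (lam : R) : 0 < lam -> grid lam (fun s => Num.ceil (lam * s)).
Proof.
move=> lam0 i; exists `](i - 1)%:~R / lam, i%:~R / lam].
have dE : i%:~R / lam - (i - 1)%:~R / lam = lam^-1.
  by rewrite -mulrBl -intrB opprB addrCA subrr addr0 mul1r.
have l0 : 0 < lam^-1 by rewrite invr_gt0.
split.
- by apply/seteqP; split => x /=; rewrite in_itv/= => /ceilEitv; apply.
- rewrite lebesgue_measure_itv/= lte_fin ifT; first by rewrite -EFinD dE.
  by rewrite -subr_gt0 dE.
- move=> x y; rewrite !in_itv/= => /andP[? ?] /andP[? ?].
  by rewrite ler_norml; lra.
Qed.

Lemma grid_floor (lam : R) : 0 < lam -> grid lam (fun s => Num.floor (lam * s)).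
Proof.
move=> lam0 i; exists `[i%:~R / lam, (i + 1)%:~R / lam[.
have dE : (i + 1)%:~R / lam - i%:~R / lam = lam^-1.
  by rewrite -mulrBl -intrB addrAC subrr add0r mul1r.
have l0 : 0 < lam^-1 by rewrite invr_gt0.
split.
- by apply/seteqP; split => x /=; rewrite in_itv/= => /floorEitv; apply.
- rewrite lebesgue_measure_itv/= lte_fin ifT; first by rewrite -EFinD dE.
  by rewrite -subr_gt0 dE.
- move=> x y; rewrite !in_itv/= => /andP[? ?] /andP[? ?].
  by rewrite ler_norml; lra.
Qed.

Section cell_mean.
Local Open Scope ereal_scope.
Variables (lam : R) (c : R -> int).
Hypotheses (lam0 : (0 < lam)%R) (gc : grid lam c).

(** The integral kernel of averaging over the cells of c. *)
Definition cell_mean (s t : R) : \bar R := (lam * (c s == c t)%:R)%:E.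

Lemma cell_meanC s t : cell_mean s t = cell_mean t s.
Proof. by rewrite /cell_mean eq_sym. Qed.

Lemma cell_mean_ge0 s t : 0 <= cell_mean s t.
Proof. by rewrite lee_fin mulr_ge0// ltW. Qed.

Lemma cell_mean_le s t : cell_mean s t <= lam%:E.
Proof.
by rewrite lee_fin -[leRHS]mulr1 ler_wpM2l// ?(ltW lam0)//; case: eqP.
Qed.

Lemma cell_mean_neq0 s t : cell_mean s t != 0 -> (`|s - t| <= lam^-1)%R.
Proof.
rewrite /cell_mean; have [cst _|] := eqVneq (c s) (c t); last first.
  by rewrite mulr0 eqxx.
have [J [cJ _ dJ]] := gc (c t); apply: dJ.
  by have : [set` J] s by rewrite -cJ.
by have : [set` J] t by rewrite -cJ.
Qed.

Lemma measurable_cell_mean : measurable_fun2 cell_mean.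
Proof.
pose D := [set p : R * R | c p.1 = c p.2].
have mD : measurable D.
  have -> : D = \bigcup_(i : int) ((c @^-1` [set i]) `*` (c @^-1` [set i])).
    apply/seteqP; split => [p /= cp|p [i _ [/= c1 c2]]]; last first.
      by rewrite /D/= c1.
    by exists (c p.1) => //; split => //=.
  apply: countable_bigcupT_measurable => // i.
  have [J [-> _ _]] := gc i.
  by apply: measurableX; exact: measurable_itv.
have -> : cell_mean = fun s t => (lam * \1_D (s, t))%:E.
  apply/funext => s; apply/funext => t; rewrite /cell_mean indicE.
  have [cst|cst] := eqVneq (c s) (c t); first by rewrite mem_set.
  by rewrite memNset//; exact/eqP.
apply/measurable_EFinP; apply: measurable_funM => //.
rewrite (_ : (fun _ => _) = \1_D); first exact: measurable_indic.
by apply/funext => -[].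
Qed.

Lemma integral_cell_mean s : \int[lebesgue_measure]_t cell_mean s t = 1.
Proof.
have [J [cJ lJ _]] := gc (c s).
transitivity (\int[lebesgue_measure]_t (lam%:E * (\1_([set` J] : set R) t)%:E)).
  apply: eq_integral => /= t _; rewrite -EFinM /cell_mean indicE -cJ.
  have [cst|cst] := eqVneq; first by rewrite mem_set.
  by rewrite memNset//= => /esym/eqP; rewrite (negbTE cst).
rewrite ge0_integralZl//; last by rewrite lee_fin ltW.
- rewrite integral_indic; [|exact: measurableT|exact: measurable_itv].
  by rewrite setIT [X in _ * X]lJ -EFinM divff// gt_eqF.
- by apply/measurable_EFinP; apply: measurable_indic; exact: measurable_itv.
Qed.

Lemma tensor_cell_mean m (s t : m.-tuple R) : tensor cell_mean s t =
  (lam ^+ m * [forall j, c (tnth s j) == c (tnth t j)]%:R)%:E.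
Proof.
rewrite /tensor prodEFin; congr EFin; rewrite big_split/= prodr_const card_ord.
congr (_ * _)%R; case: (boolP [forall j, _]) => [/forallP h|].
  by rewrite big1// => i _; rewrite h.
rewrite negb_forall => /existsP[j hj].
by rewrite (bigD1 j)//= (negbTE hj) mul0r.
Qed.

End cell_mean.

End cells.

Section energy_mean.
Local Open Scope ereal_scope.
Context {R : realType}.

(** The space average is removed at the level of the Gram kernel feat, between
    the two comparisons of feat with kap; the time average is then moved onto
    kap. *)
Lemma energy_block_mean (al : R) : (0 <= al < 1)%R ->
  exists2 C : R, (0 <= C)%R &
  forall (lam lam' : R) (c c' : R -> int), (0 < lam)%R -> (0 < lam')%R ->
  grid lam c -> grid lam' c' ->
  forall m (G : m.-tuple R -> m.-tuple R -> \bar R),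
  measurable_fun2 G -> (forall s x, 0 <= G s x) ->
  energy (leb_tuple m) (tensor (riesz al))
    (fun s x => \int[leb_tuple m]_y (tensor (cell_mean lam' c') x y *
       \int[leb_tuple m]_s' (tensor (cell_mean lam c) s s' * G s' y)))
  <= (C ^+ m)%:E * energy (leb_tuple m) (tensor (riesz al)) G.
Proof.
move=> al01.
have [phi [c1 [c2 [[c10 c20 mphi phi0] [rphi phir]]]]] := riesz_feature al01.
have [c3 c30 hc3] := riesz_cell_mean al01.
exists (c1 * c2 * c3)%R; first by rewrite !mulr_ge0.
move=> lam lam' c c' lam0 lam'0 gc gc' m G mG G0.
pose mu := leb_tuple m : {sigma_finite_measure set (m.-tuple R) -> \bar R}.
pose kap := @tensor R (riesz al) m.
pose Phi := @tensor R phi m.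
pose feat := (fun s t => \int[mu]_w (Phi s w * Phi t w)) : _ -> _ -> \bar R.
pose A := @tensor R (cell_mean lam c) m.
pose B := @tensor R (cell_mean lam' c') m.
pose F s x := \int[mu]_s' (A s s' * G s' x).
have mkap : measurable_fun2 kap.
  exact: measurable_tensor (measurable_riesz al).
have kap0 s t : 0 <= kap s t by exact: tensor_ge0 (riesz_ge0 al).
have mPhi : measurable_fun2 Phi by exact: measurable_tensor.
have Phi0 s w : 0 <= Phi s w by exact: tensor_ge0.
have mA : measurable_fun2 A.
  by apply: measurable_tensor; exact: (measurable_cell_mean gc).
have A0 s t : 0 <= A s t by exact: tensor_ge0 (cell_mean_ge0 _ lam0).
have mB : measurable_fun2 B.
  by apply: measurable_tensor; exact: (measurable_cell_mean gc').
have B0 s t : 0 <= B s t by exact: tensor_ge0 (cell_mean_ge0 _ lam'0).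
have mF : measurable_fun2 F by exact: (measurable_time_mean mu mA mG A0 G0).
have F0 s x : 0 <= F s x by apply: integral_ge0 => s' _; rewrite mule_ge0.
have mBF : measurable_fun2 (fun s x => \int[mu]_y (B x y * F s y)).
  exact: (measurable_space_mean mu mB mF B0 F0).
have BF0 s x : 0 <= \int[mu]_y (B x y * F s y).
  by apply: integral_ge0 => y _; rewrite mule_ge0.
have mphiC : measurable_fun2 (fun u s => phi s u) by exact: measurable_fun2C.
have featE s t :
    feat s t =
    tensor (fun x y => \int[lebesgue_measure]_u (phi x u * phi y u)) s t.
  by rewrite -(integral_tensorM s t mphi mphiC phi0 (fun u s => phi0 s u)).
have mfeat : measurable_fun2 feat.
  apply: (measurable_integral _
    (K := fun (p : m.-tuple R * m.-tuple R) w => Phi p.1 w * Phi p.2 w)).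
    apply: emeasurable_funM.
      apply: (measurable_fun2_comp mPhi) => //; exact: measurableT_comp.
    apply: (measurable_fun2_comp mPhi) => //; exact: measurableT_comp.
  by move=> p w; rewrite mule_ge0.
have feat0 s t : 0 <= feat s t.
  by apply: integral_ge0 => w _; rewrite mule_ge0.
have feat10 x y : 0 <= \int[lebesgue_measure]_u (phi x u * phi y u).
  by apply: integral_ge0 => w _; rewrite mule_ge0.
(* no exceptional set: this comparison also holds on the diagonal *)
have step1 : energy mu kap (fun s x => \int[mu]_y (B x y * F s y)) <=
    (c1 ^+ m)%:E * energy mu feat (fun s x => \int[mu]_y (B x y * F s y)).
  apply: (@energy_le _ _ _ mu _ (fun=> set0)) => //.
  - by rewrite exprn_ge0.
  - by move=> s; exact: negligible_set0.
  - move=> s t _; rewrite featE.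
    exact: (tensor_le c10 (riesz_ge0 al) feat10).
have step2 : energy mu feat (fun s x => \int[mu]_y (B x y * F s y)) <=
    energy mu feat F.
  apply: energy_space_mean => //.
  - move=> x; apply: integral_tensor.
    + exact: (measurable_cell_mean gc').
    + exact: (cell_mean_ge0 _ lam'0).
    + exact: integral_cell_mean.
  - move=> y; rewrite /B.
    under eq_integral do rewrite tensorC.
    apply: integral_tensor.
    + exact: (measurable_fun2C (measurable_cell_mean gc')).
    + by move=> ? ?; exact: (cell_mean_ge0 _ lam'0).
    + move=> x; under eq_integral do rewrite cell_meanC.
      exact: integral_cell_mean.
have step3 : energy mu feat F <= (c2 ^+ m)%:E * energy mu kap F.
  apply: (@energy_le _ _ _ mu _ (@diagonal_set R m)) => //.
  - by rewrite exprn_ge0.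
  - exact: negligible_diagonal.
  - move=> s t nd; rewrite featE.
    apply: (tensor_le c20 feat10 (riesz_ge0 al)) => i; apply: phir => st.
    by apply: nd; exists i.
pose kapA s' t' := \int[mu]_s ((\int[mu]_t (kap s t * A t t')) * A s s').
pose K1 s t' :=
  \int[lebesgue_measure]_t (riesz al s t * cell_mean lam c t t').
pose K2 s' t' := \int[lebesgue_measure]_s (K1 s t' * cell_mean lam c s s').
have step4 : energy mu kap F <= (c3 ^+ m)%:E * energy mu kap G.
  have -> : energy mu kap F = energy mu kapA G.
    apply: eq_integral => x _.
    exact: (quad_kernel_op mu mkap mA (measurable_fun2r x mG) kap0 A0
      (G0 ^~ x)).
  have mK1 : measurable_fun2 K1.
    apply: (measurable_integral (@lebesgue_measure R)
      (K := fun (p : R * R) t => riesz al p.1 t * cell_mean lam c t p.2)).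
      apply: emeasurable_funM.
        apply: (measurable_fun2_comp (measurable_riesz al)) => //.
        exact: measurableT_comp.
      apply: (measurable_fun2_comp (measurable_cell_mean gc)) => //.
      exact: measurableT_comp.
    by move=> p t; rewrite mule_ge0 ?riesz_ge0 ?cell_mean_ge0.
  have K10 s t : 0 <= K1 s t.
    by apply: integral_ge0 => u _; rewrite mule_ge0 ?riesz_ge0 ?cell_mean_ge0.
  have mK2 : measurable_fun2 K2.
    apply: (measurable_integral (@lebesgue_measure R)
      (K := fun (p : R * R) s => K1 s p.2 * cell_mean lam c s p.1)).
      apply: emeasurable_funM.
        apply: (measurable_fun2_comp mK1) => //.
        exact: measurableT_comp.
      apply: (measurable_fun2_comp (measurable_cell_mean gc)) => //.
      exact: measurableT_comp.
    by move=> p t; rewrite mule_ge0 ?cell_mean_ge0.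
  have K20 s t : 0 <= K2 s t.
    by apply: integral_ge0 => u _; rewrite mule_ge0 ?cell_mean_ge0.
  have -> : kapA = tensor K2.
    apply/funext => s'; apply/funext => t'.
    transitivity (\int[mu]_s
        (tensor (fun x y => cell_mean lam c y x) s' s * tensor K1 s t')).
      apply: eq_integral => s _; rewrite muleC; congr (_ * _).
      exact: (integral_tensorM s t' (measurable_riesz al)
        (measurable_cell_mean gc) (riesz_ge0 al) (cell_mean_ge0 c lam0)).
    rewrite (integral_tensorM s' t'
      (measurable_fun2C (measurable_cell_mean gc)) mK1
      (fun x y => cell_mean_ge0 c lam0 y x) K10).
    apply: eq_bigr => i _; apply: eq_integral => s _; exact: muleC.
  apply: (@energy_le _ _ _ mu _ (@diagonal_set R m)) => //.
  - exact: measurable_tensor.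
  - by rewrite exprn_ge0.
  - by move=> s t; exact: tensor_ge0.
  - exact: negligible_diagonal.
  - move=> s t nd; apply: (tensor_le c30 K20 (riesz_ge0 al)) => i.
    apply: (hc3 lam (cell_mean lam c) lam0 (measurable_cell_mean gc)).
    + by move=> x y; rewrite cell_mean_ge0 ?cell_mean_le.
    + exact: cell_mean_neq0.
    + move=> x; under eq_integral do rewrite cell_meanC.
      exact: integral_cell_mean.
    + by move=> st; apply: nd; exists i.
apply: le_trans step1 _.
apply: (@le_trans _ _ ((c1 ^+ m)%:E * ((c2 ^+ m)%:E * ((c3 ^+ m)%:E *
   energy mu kap G)))).
  apply: lee_wpmul2l; first by rewrite lee_fin exprn_ge0.
  apply: le_trans step2 _; apply: le_trans step3 _.
  by apply: lee_wpmul2l => //; rewrite lee_fin exprn_ge0.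
rewrite -[tensor _]/kap -/mu !exprMn !EFinM -!muleA; exact: lexx.
Qed.

End energy_mean.

(** * The norm as an energy *)

Section Bnorm_energy.
Local Open Scope ereal_scope.
Context {R : realType}.
Implicit Types (m : nat).

(** Only the restriction of f to [Bdomain] is known to be measurable, so |f|
    is extended by 0; this also turns integrals over the cube into full
    ones. *)
Definition abs_ext m (f : m.-tuple R * m.-tuple R -> R) (s x : m.-tuple R) :
    \bar R := ((fun p => `|f p|%:E) \_ (Bdomain m)) (s, x).

Lemma measurable_unit_cube m : measurable (@unit_cube R m).
Proof.
have -> : @unit_cube R m =
    \bigcap_(j in [set: 'I_m]) ((tnth (T := R) (n := m))^~ j @^-1` `[0%R, 1%R]).
  by apply/seteqP; split => s h j => [_|]; have := h j; rewrite /= in_itv/=;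
    [|apply].
apply: fin_bigcap_measurable => // j _.
by have := measurable_tnth j measurableT (measurable_itv `[(0:R)%R, 1%R]);
  rewrite setTI.
Qed.

Lemma measurable_Bdomain m : measurable (@Bdomain R m).
Proof. by apply: measurableX => //; exact: measurable_unit_cube. Qed.

Lemma abs_ext_ge0 m (f : m.-tuple R * m.-tuple R -> R) s x : 0 <= abs_ext f s x.
Proof. by apply: erestrict_ge0 => p _; rewrite lee_fin. Qed.

Lemma measurable_abs_ext m (f : m.-tuple R * m.-tuple R -> R) :
  measurable_fun (Bdomain m) f -> measurable_fun2 (abs_ext f).
Proof.
move=> mf; rewrite /measurable_fun2.
rewrite (_ : (fun p => _) = (fun p => `|f p|%:E) \_ (Bdomain m)).
  apply/(measurable_restrictT _ _).1; first exact: measurable_Bdomain.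
  by apply/measurable_EFinP; apply: measurableT_comp.
by apply/funext => -[].
Qed.

Lemma BkernelE H m (s t : m.-tuple R) :
  (Bkernel H s t)%:E = tensor (riesz (2 - 2 * H)) s t.
Proof.
by rewrite /Bkernel -prodEFin; apply: eq_bigr => i _; rewrite /riesz opprB.
Qed.

(** Measurability is asked of the majorant g alone, so that h can be a block
    average. *)
Lemma sqr_Bnorm_integral_le H m (h : m.-tuple R * m.-tuple R -> R)
    (g : m.-tuple R -> m.-tuple R -> \bar R) :
  measurable_fun2 g -> (forall s x, 0 <= g s x) ->
  (forall s x, unit_cube m s -> `|h (s, x)|%:E <= g s x) ->
  \int[leb_tuple m \x leb_tuple m]_(st in unit_cube m `*` unit_cube m)
    \int[leb_tuple m]_x
      (Bkernel H st.1 st.2 * `|h (st.1, x)| * `|h (st.2, x)|)%:E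
  <= energy (leb_tuple m) (tensor (riesz (2 - 2 * H))) g.
Proof.
move=> mg g0 hg.
have k0 (s t : m.-tuple R) : 0 <= tensor (riesz (2 - 2 * H)) s t.
  exact: tensor_ge0 (riesz_ge0 _).
rewrite energyE//; last exact: measurable_tensor (measurable_riesz _).
rewrite integral_mkcond; apply: ge0_le_integral_nonmeas => -[s t] _.
  apply: erestrict_ge0 => -[s' t'] _; apply: integral_ge0 => x _.
  by rewrite lee_fin !mulr_ge0// prodr_ge0// => i _; rewrite powR_ge0.
rewrite patchE; case: ifPn => [/set_mem[/= us ut]|_]; last first.
  by apply: integral_ge0 => x _; rewrite !mule_ge0.
apply: ge0_le_integral_nonmeas => x _ /=.
  by rewrite lee_fin !mulr_ge0// prodr_ge0// => i _; rewrite powR_ge0.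
rewrite !EFinM BkernelE; apply: lee_pmul => //.
- by rewrite mule_ge0.
- by apply: lee_pmul => //; exact: hg.
- exact: hg.
Qed.

Lemma sqr_Bnorm_integralE H m (f : m.-tuple R * m.-tuple R -> R) :
  measurable_fun (Bdomain m) f ->
  \int[leb_tuple m \x leb_tuple m]_(st in unit_cube m `*` unit_cube m)
    \int[leb_tuple m]_x
      (Bkernel H st.1 st.2 * `|f (st.1, x)| * `|f (st.2, x)|)%:E
  = energy (leb_tuple m) (tensor (riesz (2 - 2 * H))) (abs_ext f).
Proof.
move=> mf; rewrite energyE; last 4 first.
- exact: measurable_tensor (measurable_riesz _).
- exact: measurable_abs_ext.
- by move=> s t; exact: tensor_ge0 (riesz_ge0 _).
- exact: abs_ext_ge0.
rewrite integral_mkcond; apply: eq_integral => -[s t] _.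
rewrite patchE; case: ifPn => [/set_mem[/= us ut]|].
  apply: eq_integral => x _; rewrite !EFinM BkernelE /abs_ext !patchE.
  by rewrite !mem_set.
move=> nst; rewrite integral0_eq// => x _ /=; rewrite /abs_ext !patchE.
case: ifPn => [/set_mem[/= us _]|_]; last by rewrite mule0 mul0e.
case: ifPn => [/set_mem[/= ut _]|_]; last by rewrite mule0.
by exfalso; move/negP: nst; apply; rewrite mem_set.
Qed.

(** On the block D of (s, x), the product of the two averaging kernels is v
    times the indicator of D. Integrating it shows that v is the inverse of
    the volume of D, and integrating it against |f| gives the average of |f|
    over D. *)
Lemma le_block_avg (rho : R) m N (f : m.-tuple R * m.-tuple R -> R) s x :
  (0 < N)%N -> measurable_fun (Bdomain m) f ->
  `|block_avg N rho f (s, x)|%:E <=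
  \int[leb_tuple m]_y
    (tensor (cell_mean (N%:R `^ rho^-1)
        (fun x => Num.floor (N%:R `^ rho^-1 * x))) x y *
     \int[leb_tuple m]_s'
       (tensor (cell_mean N%:R (fun s => Num.ceil (N%:R * s))) s s' *
        abs_ext f s' y)).
Proof.
move=> N0 mf.
have lam0 : (0 < N%:R :> R)%R by rewrite ltr0n.
have lam'0 : (0 < N%:R `^ rho^-1 :> R)%R by rewrite powR_gt0.
set lam := (N%:R : R) in lam0 *.
rewrite -/lam; set lam' := (lam `^ rho^-1)%R in lam'0 *.
set c := fun s : R => Num.ceil (lam * s)%R.
set c' := fun x : R => Num.floor (lam' * x)%R.
have gc : grid lam c by exact: grid_ceil.
have gc' : grid lam' c' by exact: grid_floor.
pose mu := leb_tuple m : {sigma_finite_measure set (m.-tuple R) -> \bar R}.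
pose A := @tensor R (cell_mean lam c) m s.
pose B := @tensor R (cell_mean lam' c') m x.
have mTA : measurable_fun2 (@tensor R (cell_mean lam c) m).
  by apply: measurable_tensor; exact: (measurable_cell_mean gc).
have mA : measurable_fun setT A by exact: (measurable_fun2l s mTA).
have mTB : measurable_fun2 (@tensor R (cell_mean lam' c') m).
  by apply: measurable_tensor; exact: (measurable_cell_mean gc').
have mB : measurable_fun setT B by exact: (measurable_fun2l x mTB).
have A0 t : 0 <= A t by exact: tensor_ge0 (cell_mean_ge0 _ lam0).
have B0 t : 0 <= B t by exact: tensor_ge0 (cell_mean_ge0 _ lam'0).
rewrite /block_avg -/lam -/lam'; case: ifPn => [/forallP/= s01|_]; last first.
  rewrite normr0; apply: integral_ge0 => y _; rewrite mule_ge0//.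
  by apply: integral_ge0 => t _; rewrite mule_ge0// abs_ext_ge0.
set D := block _ _ _ _.
pose v := (lam ^+ m * lam' ^+ m)%R.
have v0 : (0 < v)%R by rewrite mulr_gt0// exprn_gt0.
have ABE q : A q.1 * B q.2 = (v * \1_D q)%:E.
  rewrite /A /B !tensor_cell_mean -EFinM mulrACA -natrM mulnb indicE.
  congr (_ * _%:R)%:E; congr nat_of_bool.
  apply/andP/idP => [[/forallP h1 /forallP h2]|/set_mem h].
    rewrite mem_set// => j; split.
      by apply/(ceilEitv _ _ lam0); exact/esym/eqP/h1.
    by apply/(floorEitv _ _ lam'0); exact/esym/eqP/h2.
  split; apply/forallP => j; have [h1 h2] := h j.
    by move/(ceilEitv _ _ lam0) : h1 => h1; exact/eqP/esym.
  by move/(floorEitv _ _ lam'0) : h2 => h2; exact/eqP/esym.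
have mD : measurable D.
  apply/measurable_indicP.
  have : measurable_fun setT (fun q => (v^-1)%:E * (A q.1 * B q.2)).
    apply: emeasurable_funM => //; apply: emeasurable_funM.
      exact: (measurableT_comp mA).
    exact: (measurableT_comp mB).
  move=> h; apply/measurable_EFinP; apply: eq_measurable_fun h => q _ /=.
  by rewrite ABE -EFinM mulrA mulVf ?mul1r ?gt_eqF.
have pair_integral g : measurable_fun2 g -> (forall t y, 0 <= g t y) ->
    \int[mu]_y (B y * \int[mu]_t (A t * g t y)) =
    \int[mu \x mu]_q ((v * \1_D q)%:E * g q.1 q.2).
  move=> mg g0; rewrite (iterated_mean_prod mu mA mB mg A0 B0 g0).
  by apply: eq_integral => q _; rewrite ABE.
have m1D : measurable_fun setT (fun q => (\1_D q)%:E : \bar R).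
  by apply/measurable_EFinP; exact: measurable_indic.
have volume : (mu \x mu) D = (v^-1)%:E.
  have A1 : \int[mu]_t A t = 1.
    apply: integral_tensor; [exact: (measurable_cell_mean gc)|
      exact: (cell_mean_ge0 _ lam0)|exact: integral_cell_mean].
  have B1 : \int[mu]_y B y = 1.
    apply: integral_tensor; [exact: (measurable_cell_mean gc')|
      exact: (cell_mean_ge0 _ lam'0)|exact: integral_cell_mean].
  have := pair_integral (fun _ _ => 1) (measurable_cst _) (fun _ _ => lee01).
  under eq_integral do under eq_integral do rewrite mule1.
  under eq_integral do rewrite A1 mule1.
  rewrite B1; under eq_integral do rewrite mule1 EFinM.
  rewrite ge0_integralZl//; last by rewrite lee_fin ltW.
  rewrite integral_indic// setIT => /esym vD.
  have : (v^-1)%:E * (v%:E * (mu \x mu) D) = (v^-1)%:E by rewrite vD mule1.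
  by rewrite muleA -EFinM mulVf ?gt_eqF// mul1e.
(* a time cell that meets ]0, 1] is contained in it, since lam is an integer *)
have DB : D `<=` Bdomain m.
  move=> q Dq; split => //= j; have [/andP[q1 q2] _] := Dq j.
  have /andP[s0 s1] := s01 j; apply/andP; split.
    apply: ltW; apply: le_lt_trans q1; rewrite divr_ge0 ?(ltW lam0)// ler0z.
    by rewrite subr_ge0 -gtz0_ge1 ceil_gt0 mulr_gt0.
  apply: le_trans q2 _; rewrite ler_pdivrMr// mul1r.
  rewrite -[leRHS]/(N%:Z%:~R) ler_int ceil_le_int.
  by rewrite -[leRHS]mulr1 ler_pM2l.
have mfD := measurable_funS (@measurable_Bdomain m) DB mf.
have -> : \int[leb_tuple m]_y
      (B y * \int[leb_tuple m]_t (A t * abs_ext f t y)) =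
    v%:E * \int[mu \x mu]_(q in D) `|f q|%:E.
  rewrite (pair_integral _ (measurable_abs_ext mf) (abs_ext_ge0 f)).
  rewrite [in RHS]integral_mkcond -ge0_integralZl//; last 3 first.
  - apply/(measurable_restrictT _ _).1 => //.
    by apply/measurable_EFinP; exact: measurableT_comp.
  - by move=> q _; apply: erestrict_ge0 => ? _; rewrite lee_fin.
  - by rewrite lee_fin ltW.
  apply: eq_integral => -[t y] _; rewrite /abs_ext /= !patchE EFinM indicE.
  have [/set_mem tyD|_] := boolP ((t, y) \in D); last by rewrite mule0 mul0e.
  by rewrite mem_set ?mule1//; exact: DB.
rewrite /average -/mu volume /= invrK normrM EFinM gtr0_norm//.
apply: lee_wpmul2l; first by rewrite lee_fin ltW.
rewrite /Rintegral; apply: (@le_trans _ _ `|\int[mu \x mu]_(q in D) (f q)%:E|).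
  by case: (\int[_]_(_ in _) _) => //= *; rewrite leey.
apply: le_trans (le_abse_integral _ _ _) _ => //.
exact/measurable_EFinP.
Qed.
End Bnorm_energy.

Theorem lemma2p2 (R : realType) (H : R) (hH : 2^-1 < H <= 1) :
  exists C : R, forall rho : R, 1 < rho <= 2 ->
    forall m N : nat, (0 < m)%N -> (0 < N)%N ->
    forall f : m.-tuple R * m.-tuple R -> R, Bspace H m f ->
      (Bnorm H (block_avg N rho f) <= (C ^+ m)%:E * Bnorm H f)%E.
Proof.
have al01 : 0 <= 2 - 2 * H < 1.
  by case/andP: hH => h1 h2; apply/andP; split; lra.
have [C C0 hC] := energy_block_mean al01.
exists (Num.sqrt C) => rho hrho m N m0 N0 f [mf _].
have lam0 : 0 < N%:R :> R by rewrite ltr0n.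
have lam'0 : 0 < N%:R `^ rho^-1 :> R by rewrite powR_gt0.
have mG := measurable_abs_ext mf.
have G0 := abs_ext_ge0 f.
have E0 :
    (0 <= energy (leb_tuple m) (tensor (riesz (2 - 2 * H))) (abs_ext f))%E.
  by apply: energy_ge0 => // s t; exact: tensor_ge0 (riesz_ge0 _).
have -> : (Num.sqrt C ^+ m)%:E = sqrte (C ^+ m)%:E.
  rewrite /=; congr EFin; elim: {m0 f mf mG G0 E0} m => [|m IH].
    by rewrite !expr0 sqrtr1.
  by rewrite !exprS sqrtrM// IH.
rewrite /Bnorm (sqr_Bnorm_integralE H mf) -sqrteM ?lee_fin ?exprn_ge0//.
rewrite lee_sqrt; last by rewrite mule_ge0 ?lee_fin ?exprn_ge0.
have gc := grid_ceil lam0; have gc' := grid_floor lam'0.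
apply: le_trans (hC _ _ _ _ lam0 lam'0 gc gc' m _ mG G0).
pose A := @tensor R (cell_mean N%:R (fun s => Num.ceil (N%:R * s))) m.
pose B := @tensor R (cell_mean (N%:R `^ rho^-1)
  (fun x => Num.floor (N%:R `^ rho^-1 * x))) m.
have mA : measurable_fun2 A.
  exact: measurable_tensor (measurable_cell_mean gc).
have mB : measurable_fun2 B.
  exact: measurable_tensor (measurable_cell_mean gc').
have A0 s t : (0 <= A s t)%E by exact: tensor_ge0 (cell_mean_ge0 _ lam0).
have B0 s t : (0 <= B s t)%E by exact: tensor_ge0 (cell_mean_ge0 _ lam'0).
have F0 s x : (0 <= \int[leb_tuple m]_s' (A s s' * abs_ext f s' x))%E.
  by apply: integral_ge0 => s' _; rewrite mule_ge0.
apply: sqr_Bnorm_integral_le.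
- apply: (measurable_space_mean (leb_tuple m) mB _ B0 F0).
  exact: (measurable_time_mean (leb_tuple m) mA mG A0 G0).
- by move=> s x; apply: integral_ge0 => y _; rewrite mule_ge0.
- by move=> s x _; exact: le_block_avg.
Qed.
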